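(* Let $\mathcal H$ be a graded connected locally finite Hopf algebra over $\mathbb R$. Let $\gamma\in\,]0,1[$ be such that $\gamma^{-1}\notin\mathbb N$, let $N=\lfloor\gamma^{-1}\rfloor$ and let $1\le n\le N-1$. Suppose $\mathbb X^n:[0,1]\to(G^n,\rho_n)$ is a $\gamma$-Hölder path. Then there is a $\gamma$-Hölder path $\mathbb X^{n+1}:[0,1]\to(G^{n+1},\rho_{n+1})$ extending $\mathbb X^n$, i.e. such that $\mathbb X^{n+1}_t|_{\mathcal H_n}=\mathbb X^n_t$ for all $t\in[0,1]$.
   Context: Graded: $\mathcal H=\bigoplus_{k\ge0}\mathcal H_{(k)}$ with product mapping $\mathcal H_{(k)}\otimes\mathcal H_{(l)}$ into $\mathcal H_{(k+l)}$ and coproduct $\Delta$ mapping $\mathcal H_{(k)}$ into $\bigoplus_{p+q=k}\mathcal H_{(p)}\otimes\mathcal H_{(q)}$; connected: $\dim\mathcal H_{(0)}=1$; locally finite: $\dim\mathcal H_{(k)}<\infty$ for all $k$. For an integer $M\ge 1$, $\mathcal H_M=\bigoplus_{k=0}^M\mathcal H_{(k)}$ is a subcoalgebra, and $\mathcal H_M^*$ is an algebra under $\langle f\star g,x\rangle=\langle f\otimes g,\Delta x\rangle$ with unit the counit $\varepsilon$. $G^M$ is the group (under $\star$) of truncated characters: $X\in\mathcal H_M^*\setminus\{0\}$ with $\langle X,xy\rangle=\langle X,x\rangle\langle X,y\rangle$ for all $x\in\mathcal H_{(k)},y\in\mathcal H_{(l)}$ with $k+l\le M$. For $f\in\mathcal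 H_M^*$, $f_{(k)}\in\mathcal H_M^*$ denotes $f$ composed with the projection onto $\mathcal H_{(k)}$. Distance: fix a basis $B$ of $\mathcal H_M$ consisting of homogeneous elements, write $\Delta v=\sum_{v_1,v_2\in B}c(v,v_1,v_2)v_1\otimes v_2$ for $v\in B$, put $K=\max_{v\in B}\sum_{v_1,v_2\in B}|c(v,v_1,v_2)|$ and $|\!|\!|f|\!|\!|=K\sup_{v\in B}|\langle f,v\rangle|$ for $f\in\mathcal H_M^*$. For $X\in G^M$ put $$|X|=\max_{1\le k\le M}\big(k!\,|\!|\!|X_{(k)}|\!|\!|\big)^{1/k}+\max_{1\le k\le M}\big(k!\,|\!|\!|(X^{-1})_{(k)}|\!|\!|\big)^{1/k},$$ and $\rho_M(X,Y)=|X^{-1}\star Y|$, a left-invariant distance on $G^M$. A path $\mathbb X:[0,1]\to G^M$ is $\gamma$-Hölder if $\rho_M(\mathbb X_s,\mathbb X_t)\le C|t-s|^\gamma$ for some $C$ and all $s,t\in[0,1]$. *)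

(* Defs.v *)
From HB Require Import structures.
From mathcomp Require Import all_boot all_order all_algebra.
From mathcomp Require Import boolp classical_sets reals exp.

Set Implicit Arguments.
Unset Strict Implicit.
Unset Printing Implicit Defensive.

Import Order.TTheory GRing.Theory Num.Theory.
Local Open Scope ring_scope.
Local Open Scope quotient_scope.

(** * Tensor product of two modules *)

Section TensorDef.
Variables (R : comNzRingType) (U V : lmodType R).

Definition tsum (W : lmodType R) (f : U -> V -> W) (s : seq (U * V)) : W :=
  \sum_(p <- s) f p.1 p.2.

(* A list of pairs stands for the sum of the corresponding pure tensors; two
   lists are identified when no bilinear map separates them.  Together with
   [tlift_tens], [tensor_ind] and [tlift_uniq] below, this is the usual
   universal property. *)
Definition teq (s t : seq (U * V)) : bool :=
  `[< forall (W : lmodType R) (f : {bilinear U -> V -> W}),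
        tsum f s = tsum f t >].

Lemma teqP s t :
  reflect (forall (W : lmodType R) (f : {bilinear U -> V -> W}),
             tsum f s = tsum f t) (teq s t).
Proof. exact: asboolP. Qed.

Lemma teq_refl : reflexive teq.
Proof. by move=> s; apply/teqP. Qed.

Lemma teq_sym : symmetric teq.
Proof.
by move=> s t; apply/teqP/teqP => e W f; rewrite (e W f).
Qed.

Lemma teq_trans : transitive teq.
Proof.
move=> t s u /teqP st /teqP tu; apply/teqP => W f.
by rewrite (st W f) (tu W f).
Qed.

Canonical teq_equiv := EquivRel teq teq_refl teq_sym teq_trans.

Definition tensor := {eq_quot teq}.

HB.instance Definition _ : EqQuotient _ teq tensor := EqQuotient.on tensor.
HB.instance Definition _ := Choice.on tensor.

Definition tens (u : U) (v : V) : tensor := \pi_tensor [:: (u, v)].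

(* The linear map on the tensor product induced by [f]; used only for bilinear
   [f], where it does not depend on the representative. *)
Definition tlift (W : lmodType R) (f : U -> V -> W) (t : tensor) : W :=
  tsum f (repr t).

Definition tadd (s t : tensor) : tensor := \pi_tensor (repr s ++ repr t).
Definition tzero : tensor := \pi_tensor [::].
Definition tscale (a : R) (t : tensor) : tensor :=
  \pi_tensor [seq (a *: p.1, p.2) | p <- repr t].
Definition topp (t : tensor) : tensor := tscale (-1) t.

Lemma pi_teqP s t :
  reflect (forall (W : lmodType R) (f : {bilinear U -> V -> W}),
             tsum f s = tsum f t) (\pi_tensor s == \pi_tensor t).
Proof. by rewrite eqmodE; exact: teqP. Qed.

Lemma tlift_pi (W : lmodType R) (f : {bilinear U -> V -> W}) s :
  tlift f (\pi_tensor s) = tsum f s.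
Proof.
have /pi_teqP e : \pi_tensor (repr (\pi_tensor s)) == \pi_tensor s.
  by rewrite reprK.
exact: e.
Qed.

Lemma tensor_eqP (s t : tensor) :
  (forall (W : lmodType R) (f : {bilinear U -> V -> W}),
     tlift f s = tlift f t) <-> s = t.
Proof.
split=> [e|-> //]; rewrite -[s]reprK -[t]reprK.
by apply/eqP/pi_teqP => W f; exact: e.
Qed.

Lemma tlift_add (W : lmodType R) (f : {bilinear U -> V -> W}) s t :
  tlift f (tadd s t) = tlift f s + tlift f t.
Proof. by rewrite tlift_pi /tsum big_cat. Qed.

Lemma tlift_zero (W : lmodType R) (f : {bilinear U -> V -> W}) :
  tlift f tzero = 0.
Proof. by rewrite tlift_pi /tsum big_nil. Qed.

Lemma tlift_scale (W : lmodType R) (f : {bilinear U -> V -> W}) a t :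
  tlift f (tscale a t) = a *: tlift f t.
Proof.
rewrite tlift_pi /tsum big_map /tlift /tsum scaler_sumr.
by apply: eq_bigr => p _; rewrite linearZl_LR.
Qed.

Lemma taddA : associative tadd.
Proof. by move=> s t u; apply/tensor_eqP => W f; rewrite !tlift_add addrA. Qed.

Lemma taddC : commutative tadd.
Proof. by move=> s t; apply/tensor_eqP => W f; rewrite !tlift_add addrC. Qed.

Lemma tadd0 : left_id tzero tadd.
Proof.
by move=> s; apply/tensor_eqP => W f; rewrite tlift_add tlift_zero add0r.
Qed.

Lemma taddN : left_inverse tzero topp tadd.
Proof.
move=> s; apply/tensor_eqP => W f.
by rewrite tlift_add tlift_scale tlift_zero scaleN1r addNr.
Qed.

HB.instance Definition _ :=
  GRing.isZmodule.Build tensor taddA taddC tadd0 taddN.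

Lemma tscaleA a b t : tscale a (tscale b t) = tscale (a * b) t.
Proof. by apply/tensor_eqP => W f; rewrite !tlift_scale scalerA. Qed.

Lemma tscale1 : left_id 1 tscale.
Proof. by move=> t; apply/tensor_eqP => W f; rewrite tlift_scale scale1r. Qed.

Lemma tscaleDr : right_distributive tscale +%R.
Proof.
move=> a s t; apply/tensor_eqP => W f.
by rewrite tlift_scale !tlift_add !tlift_scale scalerDr.
Qed.

Lemma tscaleDl t : {morph tscale^~ t : a b / a + b}.
Proof.
move=> a b; apply/tensor_eqP => W f.
by rewrite tlift_add !tlift_scale scalerDl.
Qed.

HB.instance Definition _ :=
  GRing.Zmodule_isLmodule.Build R tensor tscaleA tscale1 tscaleDr tscaleDl.

Lemma tens_bilinear : bilinear_for *:%R *:%R tens.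
Proof.
split=> [v a x y | u a x y] /=; apply/tensor_eqP => W f;
  rewrite tlift_add tlift_scale !tlift_pi /tsum !big_seq1 /=.
- by rewrite linearPl.
- by rewrite linearPr.
Qed.

HB.instance Definition _ :=
  bilinear_isBilinear.Build R U V tensor *:%R *:%R tens tens_bilinear.

Lemma tlift_tens (W : lmodType R) (f : {bilinear U -> V -> W}) u v :
  tlift f (tens u v) = f u v.
Proof. by rewrite tlift_pi /tsum big_seq1. Qed.

Lemma tlift_is_linear (W : lmodType R) (f : {bilinear U -> V -> W}) :
  linear (tlift f).
Proof. by move=> a s t; rewrite tlift_add tlift_scale. Qed.

HB.instance Definition _ (W : lmodType R) (f : {bilinear U -> V -> W}) :=
  GRing.isLinear.Build R tensor W *:%R (tlift f) (tlift_is_linear f).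

Lemma tensor_sum (t : tensor) : t = \sum_(p <- repr t) tens p.1 p.2.
Proof.
apply/tensor_eqP => W f; rewrite linear_sum /=.
by apply: eq_bigr => p _; rewrite tlift_tens.
Qed.

Lemma tensor_ind (P : tensor -> Prop) :
  P 0 -> (forall u v t, P t -> P (tens u v + t)) -> forall t, P t.
Proof.
move=> P0 PD t; rewrite (tensor_sum t).
by elim: (repr t) => [|p s IH]; rewrite (big_nil, big_cons) //; exact: PD.
Qed.

Lemma tlift_uniq (W : lmodType R) (f : {bilinear U -> V -> W})
    (g : {linear tensor -> W}) :
  (forall u v, g (tens u v) = f u v) -> g =1 tlift f.
Proof.
move=> gf; elim/tensor_ind => [|u v t IH]; first by rewrite !linear0.
by rewrite !linearD /= IH gf tlift_tens.
Qed.

End TensorDef.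

Arguments tens {R U V}.
Arguments tlift {R U V W}.

Section TensorMaps.
Variable R : comNzRingType.

Section TMap.
Variables (U V U' V' : lmodType R).
Variables (f : {linear U -> U'}) (g : {linear V -> V'}).

Definition tpair (u : U) (v : V) : tensor U' V' := tens (f u) (g v).

Lemma tpair_bilinear : bilinear_for *:%R *:%R tpair.
Proof.
by split=> [v a x y | u a x y] /=; rewrite /tpair linearP (linearPl, linearPr).
Qed.

HB.instance Definition _ :=
  bilinear_isBilinear.Build R U V (tensor U' V') *:%R *:%R tpair tpair_bilinear.

Definition tmap : tensor U V -> tensor U' V' := tlift tpair.

HB.instance Definition _ := GRing.Linear.on tmap.

Lemma tmap_tens u v : tmap (tens u v) = tens (f u) (g v).
Proof. by rewrite /tmap tlift_tens. Qed.

End TMap.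

Section Assoc.
Variables U V W : lmodType R.

Definition tassoc_pure (w : W) (u : U) (v : V) : tensor U (tensor V W) :=
  tens u (tens v w).

Lemma tassoc_pure_bilinear w : bilinear_for *:%R *:%R (tassoc_pure w).
Proof.
split=> [v a x y | u a x y] /=; rewrite /tassoc_pure.
- by rewrite linearPl.
- by rewrite linearPl linearPr.
Qed.

HB.instance Definition _ w :=
  bilinear_isBilinear.Build R U V (tensor U (tensor V W)) *:%R *:%R
    (tassoc_pure w) (tassoc_pure_bilinear w).

Definition tassoc_left (t : tensor U V) (w : W) : tensor U (tensor V W) :=
  tlift (tassoc_pure w) t.

Lemma tassoc_left_bilinear : bilinear_for *:%R *:%R tassoc_left.
Proof.
split=> [w a s t | t a x y] /=; first exact: linearP.
elim/tensor_ind: t => [|u v t IH].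
  by rewrite /tassoc_left !linear0 addr0.
rewrite /tassoc_left !linearD /= -!/(tassoc_left _ _) IH.
rewrite addrACA; congr (_ + _).
by rewrite /tassoc_left !tlift_tens /= /tassoc_pure !linearPr.
Qed.

HB.instance Definition _ :=
  bilinear_isBilinear.Build R (tensor U V) W (tensor U (tensor V W)) *:%R *:%R
    tassoc_left tassoc_left_bilinear.

Definition tassoc : tensor (tensor U V) W -> tensor U (tensor V W) :=
  tlift tassoc_left.

HB.instance Definition _ := GRing.Linear.on tassoc.

Lemma tassoc_tens u v w : tassoc (tens (tens u v) w) = tens u (tens v w).
Proof. by rewrite /tassoc tlift_tens /= /tassoc_left tlift_tens. Qed.

End Assoc.

(* The product [(a ⊗ b) (c ⊗ d) = ac ⊗ bd]. *)
Definition tmul (A B : algType R) (s t : tensor A B) : tensor A B :=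
  tlift (fun a b => tlift (fun c d => tens (a * c) (b * d)) t) s.

End TensorMaps.

HB.mixin Record Algebra_isHopf (R : comNzRingType) H of GRing.Algebra R H := {
  comul : {linear H -> tensor H H};
  counit : {scalar H};
  antipode : {linear H -> H};
  comulA : forall x : H,
    tassoc (tmap comul idfun (comul x)) = tmap idfun comul (comul x);
  counitl : forall x : H, tlift (fun a b => counit a *: b) (comul x) = x;
  counitr : forall x : H, tlift (fun a b => counit b *: a) (comul x) = x;
  comulM : forall x y : H, comul (x * y) = tmul (comul x) (comul y);
  comul1 : comul 1 = tens 1 1;
  counitM : forall x y : H, counit (x * y) = counit x * counit y;
  counit1 : counit 1 = 1;
  antipodel : forall x : H,
    tlift (fun a b => antipode a * b) (comul x) = counit x *: 1;
  antipoder : forall x : H,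
    tlift (fun a b => a * antipode b) (comul x) = counit x *: 1
}.

#[short(type="hopfType")]
HB.structure Definition Hopf (R : comNzRingType) :=
  {H of Algebra_isHopf R H & GRing.Algebra R H}.

Section Bases.
Variables (R : comNzRingType) (V : lmodType R).
Implicit Types A : set V.

Definition is_basis A d (b : 'I_d -> V) : Prop :=
  (forall i, A (b i)) /\
  (forall x, A x -> exists! a : {ffun 'I_d -> R}, x = \sum_i a i *: b i).

Definition has_dim A (d : nat) : Prop := exists b : 'I_d -> V, is_basis A b.

Definition is_subspace A : Prop :=
  A 0 /\ (forall (a : R) x y, A x -> A y -> A (a *: x + y)).

Definition decomposes (A : nat -> set V) (x : V) (u : nat -> V) : Prop :=
  (forall k, A k (u k)) /\
  (exists N, (forall k, (N <= k)%N -> u k = 0) /\ x = \sum_(k < N) u k).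

Definition is_direct_sum (A : nat -> set V) : Prop :=
  forall x, exists! u, decomposes A x u.

End Bases.

(* The image of [A ⊗ B] in [U ⊗ V]. *)
Definition tensor_sub (R : comNzRingType) (U V : lmodType R)
    (A : set U) (B : set V) : set (tensor U V) :=
  [set t | exists s : seq (U * V),
      (forall p, p \in s -> A p.1 /\ B p.2) /\ t = \sum_(p <- s) tens p.1 p.2].

(* Connected and locally finite graded Hopf algebras. *)
HB.mixin Record Hopf_isGraded (R : comNzRingType) H of Hopf R H := {
  gcomp : nat -> set H;
  gcomp_subspace : forall k, is_subspace (gcomp k);
  gcomp_direct : is_direct_sum gcomp;
  gcompM : forall k l (x y : H),
    gcomp k x -> gcomp l y -> gcomp (k + l)%N (x * y);
  gcomp_comul : forall k (x : H), gcomp k x ->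
    exists t : 'I_k.+1 -> tensor H H,
      (forall p : 'I_k.+1, tensor_sub (gcomp p) (gcomp (k - p)%N) (t p)) /\
      comul x = \sum_p t p;
  gcomp_connected : has_dim (gcomp 0%N) 1;
  gcomp_locally_finite : forall k, exists d, has_dim (gcomp k) d
}.

#[short(type="gradedHopfType")]
HB.structure Definition GradedHopf (R : comNzRingType) :=
  {H of Hopf_isGraded R H & Hopf R H}.

Section Truncation.
Variables (R : comNzRingType) (H : gradedHopfType R).

Definition hproj (k : nat) (x : H) : H := sval (cid (gcomp_direct x)) k.

Lemma hprojP (x : H) : decomposes gcomp x (hproj^~ x).
Proof. by rewrite /hproj; case: cid => u /= []. Qed.

Lemma hproj_uniq (x : H) u : decomposes gcomp x u -> hproj^~ x = u.
Proof. by rewrite /hproj; case: cid => v /= [_]; apply. Qed.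

Lemma gcomp_hproj k (x : H) : gcomp k (hproj k x).
Proof. by have [+ _] := hprojP x; apply. Qed.

Lemma decomposes_widen (x : H) u : decomposes gcomp x u ->
  exists N, (forall k, (N <= k)%N -> u k = 0) /\
    forall N', (N <= N')%N -> x = \sum_(k < N') u k.
Proof.
move=> [_ [N [u0 ->]]]; exists N; split=> // N' NN'.
rewrite -(big_mkord xpredT u) -(big_mkord xpredT u).
rewrite [RHS](@big_cat_nat _ _ _ N) //= [X in _ + X]big_nat_cond.
by rewrite [X in _ + X]big1 ?addr0 // => k /andP[/andP[/u0]].
Qed.

Lemma hproj_is_linear k : linear (hproj k).
Proof.
move=> a x y.
suff /hproj_uniq e : decomposes gcomp (a *: x + y)
   (fun k => a *: hproj k x + hproj k y) by have := congr1 (@^~ k) e.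
split=> [l|].
  by have [_] := gcomp_subspace (s := H) l; apply; exact: gcomp_hproj.
have [N [x0 sx]] := decomposes_widen (hprojP x).
have [N' [y0 sy]] := decomposes_widen (hprojP y).
exists (maxn N N'); split=> [l|].
  by rewrite geq_max => /andP[/x0 -> /y0 ->]; rewrite scaler0 addr0.
rewrite big_split /= -scaler_sumr.
by rewrite -(sx _ (leq_maxl N N')) -(sy _ (leq_maxr N N')).
Qed.

HB.instance Definition _ k :=
  GRing.isLinear.Build R H H *:%R (hproj k) (hproj_is_linear k).

Lemma hproj_id k l (x : H) : gcomp k x -> hproj l x = if l == k then x else 0.
Proof.
move=> xk; suff /hproj_uniq e : decomposes gcomp x
  (fun l => if l == k then x else 0) by have := congr1 (@^~ l) e.
split=> [m|].
  by case: eqP => [-> //|_]; have [] := gcomp_subspace (s := H) m.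
exists k.+1; split=> [m|]; first by case: eqP => // ->; rewrite ltnn.
by rewrite -big_mkcond (big_pred1 (@ord_max k)) // => i; rewrite -val_eqE.
Qed.

(* [H_M], the sum of the [H_(k)] for [k <= M] *)
Definition trunc (M : nat) : {pred H} :=
  fun x => `[< exists u : nat -> H,
                 (forall k, gcomp k (u k)) /\ x = \sum_(k < M.+1) u k >].

Lemma truncP M (x : H) :
  reflect (exists u : nat -> H,
             (forall k, gcomp k (u k)) /\ x = \sum_(k < M.+1) u k)
          (x \in trunc M).
Proof. exact: asboolP. Qed.

Lemma trunc_submod M : submod_closed (trunc M).
Proof.
split=> [|a x y /truncP[u [Gu ->]] /truncP[v [Gv ->]]]; apply/truncP.
  exists (fun=> 0); split=> [k|]; last by rewrite big1.
  by have [] := gcomp_subspace (s := H) k.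
exists (fun k => a *: u k + v k); split=> [k|].
  by have [_] := gcomp_subspace (s := H) k; apply.
by rewrite big_split /= scaler_sumr.
Qed.

HB.instance Definition _ M :=
  GRing.isSubmodClosed.Build R H (trunc M) (trunc_submod M).

Record truncated (M : nat) := Truncated {
  trunc_val :> H;
  trunc_valP : trunc_val \in trunc M
}.

HB.instance Definition _ M := [isSub for @trunc_val M].
HB.instance Definition _ M := [Choice of truncated M by <:].
HB.instance Definition _ M := [SubChoice_isSubLmodule of truncated M by <:].

Definition tproj_sum (M : nat) (x : H) : H := \sum_(k < M.+1) hproj k x.

Lemma tproj_subproof M x : tproj_sum M x \in trunc M.
Proof.
by apply/truncP; exists (hproj^~ x); split=> // k; exact: gcomp_hproj.
Qed.

(* The projection of [H] onto [H_M] along the [H_(k)] with [k > M]. *)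
Definition tproj (M : nat) (x : H) : truncated M :=
  Truncated (tproj_subproof M x).

Lemma tproj_is_linear M : linear (tproj M).
Proof.
move=> a x y; apply: val_inj => /=; rewrite /tproj_sum.
by rewrite scaler_sumr -big_split /=; apply: eq_bigr => k _; exact: linearP.
Qed.

HB.instance Definition _ M :=
  GRing.isLinear.Build R H (truncated M) *:%R (tproj M) (tproj_is_linear M).

Lemma tproj_id M (x : truncated M) : tproj M x = x.
Proof.
apply: val_inj => /=; case: x => x /= /truncP[u [Gu ->]]; rewrite /tproj_sum.
apply: eq_bigr => k _; rewrite linear_sum (bigD1 k) //= (hproj_id _ (Gu k)).
rewrite eqxx big1 ?addr0 // => j jk; rewrite (hproj_id _ (Gu j)).
by case: eqP => // e; case/eqP: jk; exact: val_inj.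
Qed.

Lemma gcomp_trunc k M (x : H) : (k <= M)%N -> gcomp k x -> x \in trunc M.
Proof.
move=> kM xk; apply/truncP; exists (fun l => if l == k then x else 0).
split=> [l|].
  by case: eqP => [-> //|_]; have [] := gcomp_subspace (s := H) l.
pose k' := Ordinal (n := M.+1) (m := k) kM.
by rewrite -big_mkcond (big_pred1 k') // => i; rewrite -val_eqE.
Qed.

Lemma trunc_le M M' (x : H) : (M <= M')%N -> x \in trunc M -> x \in trunc M'.
Proof.
move=> MM' /truncP[u [Gu ->]]; apply: rpred_sum => k _.
by apply: gcomp_trunc (Gu k); rewrite (leq_trans _ MM') // -ltnS.
Qed.

Definition tincl (M : nat) (x : truncated M) : truncated M.+1 :=
  Truncated (trunc_le (leqnSn M) (trunc_valP x)).

(* The coproduct of [H_M]: by [tcomul_val], the restriction of the one of [H]. *)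
Definition tcomul (M : nat) : truncated M -> tensor (truncated M) (truncated M) :=
  tmap (tproj M) (tproj M) \o comul \o val.

HB.instance Definition _ M := GRing.Linear.on (@tcomul M).

Lemma tcomul_val M (x : truncated M) :
  tmap val val (tcomul x) = comul (val x).
Proof.
case: x => x /= xM; rewrite /tcomul /=.
pose phi : {linear tensor H H -> tensor H H} :=
  tmap (val : truncated M -> H) (val : truncated M -> H)
    \o tmap (tproj M) (tproj M).
rewrite -[LHS]/(phi (comul x)); case/truncP: xM => u [Gu ->].
rewrite (linear_sum comul) (linear_sum phi); apply: eq_bigr => k _.
have [t [Gt ->]] := gcomp_comul _ _ (Gu k).
rewrite (linear_sum phi); apply: eq_bigr => p _.
have [s [Gs ->]] := Gt p.
rewrite (linear_sum phi); apply: eq_big_seq => -[y z] /Gs /= [yp zp].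
rewrite !tmap_tens.
have kM : (k <= M)%N by rewrite -ltnS.
have py : y \in trunc M.
  by apply: gcomp_trunc yp; rewrite (leq_trans _ kM) // -ltnS.
have pz : z \in trunc M.
  by apply: gcomp_trunc zp; rewrite (leq_trans (leq_subr _ _)).
have ty := congr1 val (tproj_id (Truncated py)).
have tz := congr1 val (tproj_id (Truncated pz)).
by move: ty tz => /= -> ->.
Qed.

End Truncation.

Section Characters.
Variables (R : comNzRingType) (H : gradedHopfType R) (M : nat).
Local Notation HM := (truncated H M).

(* [⟨f ⊗ g, x ⊗ y⟩ = ⟨f, x⟩ ⟨g, y⟩] *)
Definition dual_tens (f g : {scalar HM}) (x y : HM) : R^o := f x * g y.

Lemma dual_tens_bilinear f g : bilinear_for *:%R *:%R (dual_tens f g).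
Proof.
split=> [y a x x' | x a y y'] /=; rewrite /dual_tens linearP /=.
- by rewrite mulrDl -mulrA.
- by rewrite mulrDr mulrCA.
Qed.

HB.instance Definition _ f g :=
  bilinear_isBilinear.Build R HM HM R^o *:%R *:%R
    (dual_tens f g) (dual_tens_bilinear f g).

Definition conv_fun (f g : {scalar HM}) (x : HM) : R :=
  tlift (dual_tens f g) (tcomul x).

Lemma conv_is_scalar f g : scalar (conv_fun f g).
Proof. by move=> a x y; rewrite /conv_fun !linearP. Qed.

HB.instance Definition _ f g :=
  GRing.isLinear.Build R HM R *%R (conv_fun f g) (conv_is_scalar f g).

(* [f ⋆ g] *)
Definition conv (f g : {scalar HM}) : {scalar HM} := conv_fun f g.

Definition conv1 : {scalar HM} := counit \o val.

(* The inverse for [⋆]; it is [f] itself if [f] is not invertible, which does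
   not happen for truncated characters. *)
Definition conv_inv (f : {scalar HM}) : {scalar HM} :=
  if pselect (exists g, conv f g = conv1 /\ conv g f = conv1) is left e
  then sval (cid e) else f.

(* [f_(k)] *)
Definition dual_comp (k : nat) (f : {scalar HM}) : {scalar HM} :=
  f \o (tproj M \o (hproj k \o val)).

Record truncated_character := TruncatedCharacter {
  tchar_val :> {scalar HM};
  tchar_neq0 : exists x, tchar_val x != 0;
  tcharM : forall k l (x y xy : HM), (k + l <= M)%N ->
    gcomp k (val x) -> gcomp l (val y) -> val xy = val x * val y ->
    tchar_val xy = tchar_val x * tchar_val y
}.

End Characters.

Section Distance.
Variables (R : realType) (H : gradedHopfType R) (M : nat).
Local Notation HM := (truncated H M).

Record homogeneous_basis := HomogeneousBasis {
  hb_dim : nat;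
  hb_elt :> 'I_hb_dim -> HM;
  hb_homogeneous : forall i, exists k, gcomp k (val (hb_elt i));
  hb_basis : is_basis setT hb_elt
}.

Variable B : homogeneous_basis.

Lemma hb_tensor (t : tensor HM HM) :
  exists c : 'I_(hb_dim B) -> 'I_(hb_dim B) -> R,
    t = \sum_i \sum_j c i j *: tens (B i) (B j).
Proof.
elim/tensor_ind: t => [|u v t [c ->]].
  exists (fun _ _ => 0).
  by rewrite big1 // => i _; rewrite big1 // => j _; rewrite scale0r.
have [_ Bspan] := hb_basis B.
have [a [ea _]] := Bspan u I; have [b [eb _]] := Bspan v I.
exists (fun i j => a i * b j + c i j).
rewrite ea linear_sumlz /= -big_split; apply: eq_bigr => i _ /=.
rewrite linearZl_LR /= eb linear_sumr scaler_sumr -big_split /=.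
by apply: eq_bigr => j _; rewrite linearZr_LR /= scalerA scalerDl.
Qed.

(* [Δ v_i = Σ_(j, l) c(i, j, l) v_j ⊗ v_l] *)
Definition hb_coef (i : 'I_(hb_dim B)) :
    'I_(hb_dim B) -> 'I_(hb_dim B) -> R :=
  sval (cid (hb_tensor (tcomul (B i)))).

Lemma hb_coefE i :
  tcomul (B i) = \sum_j \sum_l hb_coef i j l *: tens (B j) (B l).
Proof. by rewrite /hb_coef; case: cid. Qed.

(* The constant [K]; here and below the maxima are of nonnegative numbers, so
   that starting them at [0] changes nothing. *)
Definition hb_const : R :=
  \big[Num.max/0]_i \sum_j \sum_l `|hb_coef i j l|.

(* [|||f|||] *)
Definition dual_norm (f : {scalar HM}) : R :=
  hb_const * \big[Num.max/0]_i `|f (B i)|.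

Definition gauge (f : {scalar HM}) : R :=
  \big[Num.max/0]_(1 <= k < M.+1)
    (k`!%:R * dual_norm (dual_comp k f)) `^ (k%:R^-1).

(* [|X|] *)
Definition tchar_size (f : {scalar HM}) : R := gauge f + gauge (conv_inv f).

Definition rho (X Y : truncated_character H M) : R :=
  tchar_size (conv (conv_inv X) Y).

(* A path indexed by [0, 1] is given by a function on [R] of which only the
   values on [0, 1] matter. *)
Definition holder_path (gamma : R) (X : R -> truncated_character H M) : Prop :=
  exists C : R, forall s t : R, 0 <= s <= 1 -> 0 <= t <= 1 ->
    rho (X s) (X t) <= C * `|t - s| `^ gamma.

End Distance.

(* Main.v *)
From HB Require Import structures.
Require Import Defs.
From mathcomp Require Import all_boot all_order all_algebra.
From mathcomp Require Import boolp classical_sets reals exp.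
From mathcomp Require Import zify ring lra.

Set Implicit Arguments.
Unset Strict Implicit.
Unset Printing Implicit Defensive.

Import Order.TTheory GRing.Theory Num.Theory.
Local Open Scope ring_scope.

(** Truncated characters of [H_n] are extended to [H_(n+1)] by [dlift], which
    respects the grading but not the convolution product.  The increments
    [S_s^-1 S_t] of the lift [S_t] of [X_t] therefore differ from the lifts
    [A_st] of the increments [X_s^-1 X_t] by a functional [h_st], concentrated in
    degree [n + 1] and vanishing on products.  Since the increments of [S] are
    multiplicative in time and [A_st] is of order [|t - s|^(gamma k)] in degree
    [k], [h] is additive in time up to [|t - s|^(gamma (n + 1))].  As
    [gamma (n + 1) < 1], additive functions of time are not unique at this order,
    but one close to [h], say [g_t - g_s], is obtained by successive dyadic
    refinement.  It depends linearly on [h], so [g_t] also vanishes on products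
    and [S_t - g_t] is the required path of characters.

    The lift is [exp (log X)], with [log X] extended by [0] to degree [n + 1].
    Characters need not be shown to correspond to infinitesimal ones: writing
    [Z] for the extension of [X] by [0], the defect of multiplicativity of
    [Z^m] in total degree [n + 1] is [m X(a) X(b)], and both sides being
    polynomial in [m] one compares coefficients. *)

(** * The module of linear functionals *)

Section ScalarModule.
Variables (R : comNzRingType) (V : lmodType R).
Implicit Types f g : {scalar V}.

Lemma scalar_ext f g : f =1 g -> f = g.
Proof.
case: f g => f [[fA] [fS]] [g [[gA] [gS]]] /= /funext e.
move: e fA fS gA gS => -> fA fS gA gS.
by rewrite (Prop_irrelevance fA gA) (Prop_irrelevance fS gS).
Qed.

Lemma scalar_fun_add_subproof f g : scalar (fun x => f x + g x).
Proof. by move=> a x y; rewrite !linearP /= mulrDr addrACA. Qed.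

Lemma scalar_fun_scale_subproof (c : R) f : scalar (fun x => c * f x).
Proof. by move=> a x y; rewrite linearP /= mulrDr mulrCA. Qed.

Lemma scalar_fun_zero_subproof : scalar (fun _ : V => 0 : R).
Proof. by move=> a x y; rewrite mulr0 addr0. Qed.

Definition mk_scalar (f : V -> R) (lf : scalar f) : {scalar V} :=
  HB.pack f (GRing.isLinear.Build R V R *%R f lf).

Definition scalar_add f g := mk_scalar (scalar_fun_add_subproof f g).
Definition scalar_scale c f := mk_scalar (scalar_fun_scale_subproof c f).
Definition scalar_zero := mk_scalar scalar_fun_zero_subproof.

HB.instance Definition _ := gen_eqMixin {scalar V}.
HB.instance Definition _ := gen_choiceMixin {scalar V}.

Lemma scalar_addA : associative scalar_add.
Proof. by move=> f g h; apply: scalar_ext => x /=; rewrite addrA. Qed.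

Lemma scalar_addC : commutative scalar_add.
Proof. by move=> f g; apply: scalar_ext => x /=; rewrite addrC. Qed.

Lemma scalar_add0 : left_id scalar_zero scalar_add.
Proof. by move=> f; apply: scalar_ext => x /=; rewrite add0r. Qed.

Lemma scalar_addN : left_inverse scalar_zero (scalar_scale (-1)) scalar_add.
Proof. by move=> f; apply: scalar_ext => x /=; rewrite mulN1r addNr. Qed.

HB.instance Definition _ := GRing.isZmodule.Build {scalar V}
  scalar_addA scalar_addC scalar_add0 scalar_addN.

Lemma scalar_scaleA a b f :
  scalar_scale a (scalar_scale b f) = scalar_scale (a * b) f.
Proof. by apply: scalar_ext => x /=; rewrite mulrA. Qed.

Lemma scalar_scale1 : left_id 1 scalar_scale.
Proof. by move=> f; apply: scalar_ext => x /=; rewrite mul1r. Qed.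

Lemma scalar_scaleDr : right_distributive scalar_scale +%R.
Proof. by move=> a f g; apply: scalar_ext => x /=; rewrite mulrDr. Qed.

Lemma scalar_scaleDl f : {morph scalar_scale^~ f : a b / a + b}.
Proof. by move=> a b; apply: scalar_ext => x /=; rewrite mulrDl. Qed.

HB.instance Definition _ := GRing.Zmodule_isLmodule.Build R {scalar V}
  scalar_scaleA scalar_scale1 scalar_scaleDr scalar_scaleDl.

Lemma scalarDE f g x : (f + g) x = f x + g x. Proof. by []. Qed.
Lemma scalarNE f x : (- f) x = - f x. Proof. exact: mulN1r. Qed.
Lemma scalarBE f g x : (f - g) x = f x - g x.
Proof. by rewrite scalarDE scalarNE. Qed.
Lemma scalarZE c f x : (c *: f) x = c * f x. Proof. by []. Qed.
Lemma scalar0E x : (0 : {scalar V}) x = 0. Proof. by []. Qed.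

Lemma scalar_sumE I (r : seq I) (P : pred I) (F : I -> {scalar V}) x :
  (\sum_(i <- r | P i) F i) x = \sum_(i <- r | P i) F i x.
Proof.
elim: r => [|i r IH]; first by rewrite !big_nil.
by rewrite !big_cons; case: ifP => _ //; rewrite scalarDE IH.
Qed.

Lemma scalarMnE f k x : (f *+ k) x = f x *+ k.
Proof. by elim: k => [|k IH]; rewrite ?mulr0n // !mulrS scalarDE IH. Qed.

End ScalarModule.

(** * Tensor products of functionals *)

Section TensorForms.
Variable R : comNzRingType.

Section Form.
Variables U V : lmodType R.

Definition form_fun (F : {scalar U}) (G : {scalar V}) (u : U) (v : V) : R^o :=
  F u * G v.

Lemma form_bilinear F G : bilinear_for *:%R *:%R (form_fun F G).
Proof.
split=> [y a x x' | x a y y'] /=; rewrite /form_fun linearP /=.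
- by rewrite mulrDl -mulrA.
- by rewrite mulrDr mulrCA.
Qed.

HB.instance Definition _ F G :=
  bilinear_isBilinear.Build R U V R^o *:%R *:%R
    (form_fun F G) (form_bilinear F G).

Lemma tlift_form_scalar F G : scalar (tlift (form_fun F G) : _ -> R).
Proof. by move=> a x y; rewrite linearP. Qed.

(* [F ⊗ G] *)
Definition tform F G : {scalar tensor U V} :=
  mk_scalar (tlift_form_scalar F G).

Lemma tform_tens F G u v : tform F G (tens u v) = F u * G v.
Proof. by rewrite /= tlift_tens. Qed.

Lemma tensor_scalar_ext (F G : {scalar tensor U V}) :
  (forall u v, F (tens u v) = G (tens u v)) -> F =1 G.
Proof.
move=> e; elim/tensor_ind => [|u v t IH]; first by rewrite !linear0.
by rewrite !linearD /= IH e.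
Qed.

Lemma tform_sum F G (s : seq (U * V)) :
  tform F G (\sum_(p <- s) tens p.1 p.2) = \sum_(p <- s) F p.1 * G p.2.
Proof. by rewrite linear_sum; apply: eq_bigr => p _; exact: tform_tens. Qed.

End Form.

Section ComposeScalar.
Variables (U V : lmodType R) (F : {scalar V}) (f : {linear U -> V}).

Lemma scalar_comp_subproof : scalar (F \o f).
Proof. by move=> a x y; rewrite /= !linearP. Qed.

Definition scalar_comp : {scalar U} := mk_scalar scalar_comp_subproof.

End ComposeScalar.

Lemma tform_tmap (U V U' V' : lmodType R) (F : {scalar U'}) (G : {scalar V'})
    (f : {linear U -> U'}) (g : {linear V -> V'}) t :
  tform F G (tmap f g t) = tform (scalar_comp F f) (scalar_comp G g) t.
Proof.
apply: (tensor_scalar_ext (F := scalar_comp (tform F G) (tmap f g))) => u v.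
by rewrite tform_tens /= tmap_tens tlift_tens.
Qed.

Lemma tform_tassoc (U V W : lmodType R)
    (F : {scalar U}) (G : {scalar V}) (K : {scalar W}) t :
  tform F (tform G K) (tassoc t) = tform (tform F G) K t.
Proof.
apply: (tensor_scalar_ext
  (F := scalar_comp (tform F (tform G K)) (@tassoc R U V W))) => u w.
rewrite tform_tens.
(* For fixed [w] both sides are functionals of a tensor in [U ⊗ V], so the reduction to pure tensors
   applies a second time. *)
have lw : scalar (fun u => tform F (tform G K) (@tassoc R U V W (tens u w))).
  by move=> a x y; rewrite linearPl !linearP.
rewrite -[LHS]/(mk_scalar lw u) -[tform F G u * K w]mulrC -scalarZE.
apply: tensor_scalar_ext => {}u v.
rewrite -[LHS]/(tform F (tform G K) (tassoc (tens (tens u v) w))).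
by rewrite tassoc_tens scalarZE !tform_tens mulrA mulrC.
Qed.

Section MulForm.
Variable A : algType R.

Lemma scalar_mull_subproof (F : {scalar A}) a : scalar (fun x => F (a * x)).
Proof. by move=> c x y; rewrite mulrDr -scalerAr linearP. Qed.

Lemma scalar_mulr_subproof (F : {scalar A}) a : scalar (fun x => F (x * a)).
Proof. by move=> c x y; rewrite mulrDl -scalerAl linearP. Qed.

(** [tmul] computes with chosen representatives of both tensors, so the given decompositions have to
    be exchanged for these. This is done one factor at a time: with the other factor fixed, the sum
    is the value of a functional on the tensor itself. *)
Lemma tform_tmul (F G : {scalar A}) (s t : seq (A * A)) :
  tform F G (tmul (\sum_(p <- s) tens p.1 p.2) (\sum_(q <- t) tens q.1 q.2)) =
  \sum_(p <- s) \sum_(q <- t) F (p.1 * q.1) * G (p.2 * q.2).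
Proof.
set x := \sum_(p <- s) tens _ _; set y := \sum_(q <- t) tens _ _.
have -> : tform F G (tmul x y) =
    \sum_(p <- repr x) \sum_(q <- repr y) F (p.1 * q.1) * G (p.2 * q.2).
  rewrite /tmul {1}/tlift /tsum (linear_sum (tform F G)); apply: eq_bigr => p _.
  rewrite {1}/tlift /tsum (linear_sum (tform F G)).
  by apply: eq_bigr => q _; rewrite tform_tens.
pose Fr q := tform (mk_scalar (scalar_mulr_subproof F q.1))
                   (mk_scalar (scalar_mulr_subproof G q.2)).
pose Fl p := tform (mk_scalar (scalar_mull_subproof F p.1))
                   (mk_scalar (scalar_mull_subproof G p.2)).
have E r : \sum_(p <- s) F (p.1 * r.1) * G (p.2 * r.2) =
    \sum_(p <- repr x) F (p.1 * r.1) * G (p.2 * r.2).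
  have := congr1 (Fr r) (tensor_sum x).
  by rewrite {1}/x !tform_sum /=.
rewrite exchange_big [RHS]exchange_big /=.
transitivity (\sum_(q <- repr y) \sum_(p <- s) F (p.1 * q.1) * G (p.2 * q.2)).
  by apply: eq_bigr => q _; rewrite -E.
rewrite exchange_big [RHS]exchange_big /=; apply: eq_bigr => p _.
have := congr1 (Fl p) (tensor_sum y).
by rewrite {1}/y !tform_sum /=.
Qed.

End MulForm.

End TensorForms.

(** * The coproduct of a connected graded Hopf algebra *)

Section GradedHopf.
Variables (R : comNzRingType) (H : gradedHopfType R).
Implicit Types (x y : H) (k l : nat).

Lemma gcompP k (a : R) x y : gcomp k x -> gcomp k y -> gcomp k (a *: x + y).
Proof. by have [_] := gcomp_subspace (s := H) k; apply. Qed.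

Lemma gcomp0 k : gcomp k (0 : H).
Proof. by have [] := gcomp_subspace (s := H) k. Qed.

Lemma gcompZ k (a : R) x : gcomp k x -> gcomp k (a *: x).
Proof. by move=> xk; rewrite -[_ *: _]addr0; apply: gcompP => //; exact: gcomp0. Qed.

Lemma gcompD k x y : gcomp k x -> gcomp k y -> gcomp k (x + y).
Proof. by move=> xk yk; rewrite -[x]scale1r; exact: gcompP. Qed.

Lemma gcomp_sum k (I : eqType) (r : seq I) (F : I -> H) :
  (forall i, i \in r -> gcomp k (F i)) -> gcomp k (\sum_(i <- r) F i).
Proof.
elim: r => [|i r IH] Fk; first by rewrite big_nil; exact: gcomp0.
rewrite big_cons; apply: gcompD; first by apply: Fk; rewrite mem_head.
by apply: IH => j jr; apply: Fk; rewrite in_cons jr orbT.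
Qed.

Lemma hproj_sum_widen x :
  exists N, forall N', (N <= N')%N -> x = \sum_(k < N') hproj k x.
Proof. by have [N [_ xN]] := decomposes_widen (hprojP x); exists N. Qed.

(** Right multiplication by the degree-0 component of 1 fixes every homogeneous [y]: take the
    component of [y = y * 1] in the degree of [y]. It is therefore the identity, and it is applied
    to 1. *)
Lemma gcomp_one : gcomp 0 (1 : H).
Proof.
have [N /(_ _ (leqnSn N)) e1] := hproj_sum_widen 1.
suff e x : x = x * hproj 0 1 by rewrite (e 1) mul1r; exact: gcomp_hproj.
have ek k y : gcomp k y -> y = y * hproj 0 1.
  move=> yk; have := hproj_id k yk; rewrite eqxx => {1}<-.
  have -> : hproj k y = hproj k (y * \sum_(i < N.+1) hproj i 1).
    by rewrite -e1 mulr1.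
  rewrite mulr_sumr linear_sum big_ord_recl /=.
  rewrite (@hproj_id _ _ (k + 0)) ?addn0 ?eqxx; last first.
    by rewrite -[X in gcomp X](addn0 k); apply: gcompM; last exact: gcomp_hproj.
  rewrite big1 ?addr0 // => i _.
  rewrite (hproj_id _ (gcompM _ _ _ _ yk (gcomp_hproj _ _))).
  by rewrite /= -[X in X == _]addn0 eqn_add2l.
have [N' xN'] := hproj_sum_widen x.
rewrite (xN' _ (leqnn N')) mulr_suml; apply: eq_bigr => i _.
by apply: ek; exact: gcomp_hproj.
Qed.

(** Degree 0 is a line, and [counit 1 = 1] fixes the scalar. *)
Lemma counit_gcomp0 x : gcomp 0 x -> x = counit x *: 1.
Proof.
have [b [b0 bspan]] := gcomp_connected (s := H) => x0.
have [a [xE _]] := bspan x x0; have [u [uE _]] := bspan 1 gcomp_one.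
rewrite !big_ord1 in xE uE.
have ub : u 0 * counit (b 0) = 1.
  by rewrite -[LHS](scalarZ (counit (s := H))) -uE counit1.
have -> : counit x = a 0 * counit (b 0) by rewrite xE scalarZ.
by rewrite uE scalerA -mulrA [counit _ * _]mulrC ub mulr1.
Qed.

Definition strict_degrees k (s : seq (H * H)) : Prop :=
  forall p, p \in s ->
    exists i, [/\ (0 < i < k)%N, gcomp i p.1 & gcomp (k - i)%N p.2].

(** Named versions of the maps in [counitl] and [counitr], so that their [tlift] is known to be
    linear. *)
Definition counit_actl (a b : H) : H := counit a *: b.
Definition counit_actr (a b : H) : H := counit b *: a.

Lemma counit_actl_bilinear : bilinear_for *:%R *:%R counit_actl.
Proof.
split=> [v a x y | u a x y] /=; rewrite /counit_actl.
  by rewrite linearP /= scalerDl scalerA.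
by rewrite scalerDr !scalerA mulrC.
Qed.

Lemma counit_actr_bilinear : bilinear_for *:%R *:%R counit_actr.
Proof.
split=> [v a x y | u a x y] /=; rewrite /counit_actr.
  by rewrite scalerDr !scalerA mulrC.
by rewrite linearP /= scalerDl scalerA.
Qed.

HB.instance Definition _ := bilinear_isBilinear.Build R H H H *:%R *:%R
  counit_actl counit_actl_bilinear.
HB.instance Definition _ := bilinear_isBilinear.Build R H H H *:%R *:%R
  counit_actr counit_actr_bilinear.

Lemma strict_degrees_sum k (I : Type) (r : seq I) (P : pred I)
    (t : I -> tensor H H) :
  (forall i, P i -> exists s, strict_degrees k s /\
      t i = \sum_(p <- s) tens p.1 p.2) ->
  exists s, strict_degrees k s /\
    \sum_(i <- r | P i) t i = \sum_(p <- s) tens p.1 p.2.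
Proof.
move=> tP; elim: r => [|i r [s [sk IH]]]; first by exists [::]; rewrite !big_nil.
rewrite big_cons; case: ifP => [/tP[s' [sk' ->]]|_]; last by exists s.
exists (s' ++ s); split; last by rewrite big_cat IH.
by move=> p; rewrite mem_cat => /orP[/sk'|/sk].
Qed.

(** In the two extreme bidegrees one factor has degree 0, hence is a multiple of 1; moving the
    scalars to the other factor gives [u] and [v]. *)
Lemma comul_split k x : (0 < k)%N -> gcomp k x ->
  exists u v s, [/\ gcomp k u, gcomp k v, strict_degrees k s &
    comul x = tens 1 u + tens v 1 + \sum_(p <- s) tens p.1 p.2].
Proof.
case: k => // k _ xk; have [t [tk ->]] := gcomp_comul _ _ xk.
rewrite big_ord_recl big_ord_recr /=.
have [s0 [s0P ->]] := tk ord0; have [s1 [s1P ->]] := tk (lift ord0 ord_max).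
have [s [sk ->]] : exists s, strict_degrees k.+1 s /\
    \sum_(i < k) t (lift ord0 (widen_ord (leqnSn k) i)) =
    \sum_(p <- s) tens p.1 p.2.
  apply: strict_degrees_sum => i _.
  have [s [sP ->]] := tk (lift ord0 (widen_ord (leqnSn k) i)).
  exists s; split=> // p /sP[p1 p2]; exists i.+1; split=> //=.
  by rewrite !ltnS.
exists (\sum_(p <- s0) counit p.1 *: p.2), (\sum_(p <- s1) counit p.2 *: p.1), s.
split=> //.
- by apply: gcomp_sum => p /s0P[_]; rewrite subn0 => /gcompZ.
- by apply: gcomp_sum => p /s1P[+ _] => /gcompZ.
rewrite [X in _ + X]addrC addrA; congr (_ + _ + _).
  rewrite linear_sumr; apply: eq_big_seq => p /s0P[/counit_gcomp0 e _].
  by rewrite {1}e linearZl_LR linearZr_LR.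
rewrite linear_sumlz; apply: eq_big_seq => p /s1P[_].
rewrite /= subnn => /counit_gcomp0 e.
by rewrite {1}e linearZr_LR linearZl_LR.
Qed.

(** The counit laws applied to [comul_split] express [x] in two ways. Their components of degree [k]
    give [u = x] and [v = x], and the component of degree 0 of the first gives [counit x = 0]. *)
Lemma comul_gcomp k x : (0 < k)%N -> gcomp k x ->
  counit x = 0 /\
  exists s, strict_degrees k s /\
    comul x = \sum_(p <- [:: (1, x), (x, 1) & s]) tens p.1 p.2.
Proof.
move=> k0 xk; have [u [v [s [uk vk sk xE]]]] := comul_split k0 xk.
(* The counit leaves each term of [s] in a degree strictly between 0 and [k], so none contributes to
   degree 0 or [k]. *)
have hs1 l : (l == 0%N) || (l == k) ->
    hproj l (\sum_(p <- s) counit_actl p.1 p.2) = 0.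
  move=> lk; rewrite linear_sum big_seq big1 // => p /sk[i [/andP[i0 ik] _ pk]].
  rewrite /counit_actl /= (hproj_id _ (gcompZ _ pk)); case: eqP => // le.
  by case/orP: lk; rewrite le; lia.
have hs2 l : (l == k) -> hproj l (\sum_(p <- s) counit_actr p.1 p.2) = 0.
  move=> /eqP->; rewrite linear_sum big_seq big1 // => p /sk[i [/andP[i0 ik] pk _]].
  by rewrite /counit_actr /= (hproj_id _ (gcompZ _ pk)) gtn_eqF.
have El : x = u + counit v *: 1 + \sum_(p <- s) counit_actl p.1 p.2.
  rewrite -[LHS]counitl -/counit_actl xE !linearD /= !tlift_tens.
  rewrite -[X in X + _ + _ = _]/(counit 1 *: u) counit1 scale1r.
  rewrite -[X in _ + X + _ = _]/(counit v *: 1).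
  congr (_ + _).
  by rewrite linear_sum; apply: eq_bigr => p _; exact: tlift_tens.
have Er : x = counit u *: 1 + v + \sum_(p <- s) counit_actr p.1 p.2.
  rewrite -[LHS]counitr -/counit_actr xE !linearD /= !tlift_tens.
  rewrite -[X in X + _ + _ = _]/(counit u *: 1).
  rewrite -[X in _ + X + _ = _]/(counit 1 *: v) counit1 scale1r.
  congr (_ + _).
  by rewrite linear_sum; apply: eq_bigr => p _; exact: tlift_tens.
have c0 : gcomp 0 (counit u *: (1 : H)) by apply/gcompZ/gcomp_one.
have c0' : gcomp 0 (counit v *: (1 : H)) by apply/gcompZ/gcomp_one.
have kF : (k == 0%N) = false by rewrite gtn_eqF.
have kF' : (0%N == k) = false by rewrite ltn_eqF.
have xu : x = u.
  have := congr1 (hproj k) El; rewrite !linearD /= hs1 ?eqxx ?orbT //.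
  by rewrite !(hproj_id _ xk, hproj_id _ uk, hproj_id _ c0') eqxx kF !addr0.
have xv : x = v.
  have := congr1 (hproj k) Er; rewrite !linearD /= hs2 ?eqxx //.
  by rewrite !(hproj_id _ xk, hproj_id _ vk, hproj_id _ c0) eqxx kF add0r addr0.
split.
  have := congr1 (hproj 0) El; rewrite !linearD /= hs1 ?eqxx //.
  rewrite !(hproj_id _ xk, hproj_id _ uk, hproj_id _ c0') eqxx kF' add0r addr0.
  by rewrite -xv => /(congr1 (counit (s := H))); rewrite linear0 linearZ /= counit1 mulr1.
exists s; split=> //; rewrite !big_cons /= addrA xE; congr (_ + _).
by rewrite -xu -xv.
Qed.

End GradedHopf.

(** * The convolution ring *)

Section ConvolutionRing.
Variables (R : comNzRingType) (H : gradedHopfType R) (M : nat).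
Local Notation HM := (truncated H M).
Implicit Types (f g h : {scalar HM}) (k l : nat).

(** Extension by zero to all of [H]: functionals of different levels can be compared on the same
    elements, and no proof of membership in [trunc M] is carried along. *)
Definition dext f : {scalar H} := scalar_comp f (tproj M).

Lemma dextE f a : dext f a = f (tproj M a). Proof. by []. Qed.

Lemma dextB f g a : dext (f - g) a = dext f a - dext g a.
Proof. exact: scalarBE. Qed.

Lemma dext_val f x : dext f (val x) = f x.
Proof. by rewrite dextE tproj_id. Qed.

Lemma tproj_gcomp k (a : H) : (k <= M)%N -> gcomp k a -> val (tproj M a) = a.
Proof.
by move=> kM /(gcomp_trunc kM) aM; have /(congr1 val) := tproj_id (Truncated aM).
Qed.

Lemma conv_form f g x : conv f g x = tform f g (tcomul x).
Proof. by []. Qed.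

Lemma convE f g x : conv f g x = tform (dext f) (dext g) (comul (val x)).
Proof. exact: (tform_tmap f g (tproj M) (tproj M) (comul _)). Qed.

(** Coassociativity is stated on [H], so both bracketings are moved there, through [tcomul_val] for
    the outer product and [convE] for the inner one. *)
Lemma conv_assoc : associative (@conv R H M).
Proof.
move=> f g h; apply: scalar_ext => x.
pose c F G : {scalar H} := scalar_comp (tform F G) comul.
transitivity (tform (dext f) (c (dext g) (dext h)) (comul (val x))).
  rewrite conv_form -tcomul_val tform_tmap.
  apply: tensor_scalar_ext => u v; rewrite !tform_tens.
  by congr (_ * _); [rewrite /= tproj_id|exact: convE].
transitivity (tform (c (dext f) (dext g)) (dext h) (comul (val x))); last first.
  rewrite conv_form -tcomul_val tform_tmap.
  apply: tensor_scalar_ext => u v; rewrite !tform_tens.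
  by congr (_ * _); [symmetry; exact: convE|rewrite /= tproj_id].
have el t : tform (c (dext f) (dext g)) (dext h) t =
    tform (tform (dext f) (dext g)) (dext h) (tmap comul idfun t).
  by rewrite tform_tmap; apply: tensor_scalar_ext => u v; rewrite !tform_tens.
have er t : tform (dext f) (c (dext g) (dext h)) t =
    tform (dext f) (tform (dext g) (dext h)) (tmap idfun comul t).
  by rewrite tform_tmap; apply: tensor_scalar_ext => u v; rewrite !tform_tens.
by rewrite el er -comulA tform_tassoc.
Qed.

Lemma conv_1l : left_id (@conv1 R H M) (@conv R H M).
Proof.
move=> f; apply: scalar_ext => x; rewrite -[RHS]dext_val -[X in _ = dext f X]counitl.
rewrite conv_form /tlift /tsum (linear_sum (dext f)).
transitivity (tform counit (dext f) (comul (val x))).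
  rewrite -tcomul_val [RHS]tform_tmap.
  by apply: tensor_scalar_ext => u v; rewrite !tform_tens /= tproj_id.
rewrite {1}(tensor_sum (comul _)) tform_sum; apply: eq_bigr => p _.
by rewrite scalarZ.
Qed.

Lemma conv_1r : right_id (@conv1 R H M) (@conv R H M).
Proof.
move=> f; apply: scalar_ext => x; rewrite -[RHS]dext_val -[X in _ = dext f X]counitr.
rewrite conv_form /tlift /tsum (linear_sum (dext f)).
transitivity (tform (dext f) counit (comul (val x))).
  rewrite -tcomul_val [RHS]tform_tmap.
  by apply: tensor_scalar_ext => u v; rewrite !tform_tens /= tproj_id.
rewrite {1}(tensor_sum (comul _)) tform_sum; apply: eq_bigr => p _.
by rewrite scalarZ mulrC.
Qed.

Lemma conv_Dl : left_distributive (@conv R H M) +%R.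
Proof.
move=> f g h; apply: scalar_ext => x; rewrite scalarDE !conv_form -scalarDE.
by apply: tensor_scalar_ext => u v; rewrite scalarDE !tform_tens mulrDl.
Qed.

Lemma conv_Dr : right_distributive (@conv R H M) +%R.
Proof.
move=> f g h; apply: scalar_ext => x; rewrite scalarDE !conv_form -scalarDE.
by apply: tensor_scalar_ext => u v; rewrite scalarDE !tform_tens mulrDr.
Qed.

Lemma conv1_one : conv1 H M (tproj M (1 : H)) = 1 :> R.
Proof. rewrite -[LHS]/(counit (val (tproj M 1))).
by rewrite (tproj_gcomp _ (gcomp_one H)) // counit1. Qed.

Lemma conv1_neq0 : conv1 H M != 0.
Proof.
apply/eqP => e; have := conv1_one; rewrite e => /eqP.
by rewrite eq_sym oner_eq0.
Qed.

HB.instance Definition _ := GRing.Zmodule_isNzRing.Build {scalar HM}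
  conv_assoc conv_1l conv_1r conv_Dl conv_Dr conv1_neq0.

Lemma convM f g : conv f g = f * g. Proof. by []. Qed.

Lemma dext1 k a : (k <= M)%N -> gcomp k a -> dext 1 a = counit a.
Proof.
by move=> kM ak; rewrite -[LHS]/(counit (val (tproj M a))) (tproj_gcomp kM).
Qed.

End ConvolutionRing.

(** * Multiplicativity up to a total degree *)

Section Multiplicativity.
Variables (R : comNzRingType) (H : gradedHopfType R).
Implicit Types (F G : {scalar H}) (a b : H) (j k l : nat).

(** For [F = dext f] and [j = M] these are the truncated characters, normalised by [F 1 = 1] instead
    of by being nonzero; smaller [j] serve for induction on the degree. *)
Definition multiplicative_upto j F : Prop :=
  F 1 = 1 /\ forall k l a b, (k + l <= j)%N -> gcomp k a -> gcomp l b ->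
    F (a * b) = F a * F b.

Definition defect F a b : R := F a * F b - F (a * b).

Lemma multiplicative_gcomp0 F a b : F 1 = 1 -> gcomp 0 a ->
  F (a * b) = F a * F b /\ F (b * a) = F b * F a.
Proof.
move=> F1 /counit_gcomp0->; rewrite -scalerAl -scalerAr mul1r mulr1 !scalarZ F1.
by rewrite mulr1; split=> //; exact: mulrC.
Qed.

Lemma multiplicative_upto0 F : F 1 = 1 -> multiplicative_upto 0 F.
Proof.
move=> F1; split=> // k l a b; rewrite leqn0 addn_eq0 => /andP[/eqP-> _] a0 _.
by have [] := multiplicative_gcomp0 b F1 a0.
Qed.

(** Elements of degree 0 are multiples of 1, so pairs with a factor in degree 0 are covered by
    [F 1 = 1]. *)
Lemma multiplicative_uptoS j F : multiplicative_upto j F ->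
  (forall k l a b, (0 < k)%N -> (0 < l)%N -> (k + l = j.+1)%N ->
     gcomp k a -> gcomp l b -> defect F a b = 0) ->
  multiplicative_upto j.+1 F.
Proof.
move=> [F1 Fj] Fd; split=> // k l a b; rewrite leq_eqVlt => /orP[/eqP klj|].
  move=> ak bl; case: (posnP k) => [k0|k0].
    by rewrite k0 in ak; have [] := multiplicative_gcomp0 b F1 ak.
  case: (posnP l) => [l0|l0].
    by rewrite l0 in bl; have [] := multiplicative_gcomp0 a F1 bl.
  by have /eqP := Fd _ _ _ _ k0 l0 klj ak bl; rewrite subr_eq0 => /eqP.
by rewrite ltnS; exact: Fj.
Qed.

Lemma multiplicative_upto_le i j F : (i <= j)%N ->
  multiplicative_upto j F -> multiplicative_upto i F.
Proof.
move=> ij [F1 Fj]; split=> // k l a b kli; apply: Fj.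
exact: leq_trans kli ij.
Qed.

Lemma multiplicative_counit j : multiplicative_upto j counit.
Proof. by split=> [|k l a b _ _ _]; [exact: counit1|exact: counitM]. Qed.

Lemma eq_multiplicative_upto j F G :
  (forall k a, (k <= j)%N -> gcomp k a -> F a = G a) ->
  multiplicative_upto j F -> multiplicative_upto j G.
Proof.
move=> FG [F1 Fj]; split=> [|k l a b klj ak bl].
  by rewrite -(FG _ _ (leq0n j) (gcomp_one H)).
rewrite -(FG _ _ klj (gcompM _ _ _ _ ak bl)) (Fj k l) //.
by rewrite (FG _ _ _ ak) ?(FG _ _ _ bl) //; lia.
Qed.

End Multiplicativity.

(** * Characters, nilpotency and inverses under convolution *)

Section Convolution.
Variables (R : comNzRingType) (H : gradedHopfType R) (M : nat).
Local Notation HM := (truncated H M).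
Implicit Types (f g h : {scalar HM}) (a b : H) (i j k l : nat).

Lemma dextM f g k a s : (k <= M)%N -> gcomp k a ->
  comul a = \sum_(p <- s) tens p.1 p.2 ->
  dext (f * g) a = \sum_(p <- s) dext f p.1 * dext g p.2.
Proof.
by move=> kM ak e; rewrite -tform_sum -e -[in RHS](tproj_gcomp kM ak) -convE.
Qed.

Lemma dextM1 f g : dext (f * g) 1 = dext f 1 * dext g 1.
Proof.
rewrite (dextM (s := [:: (1, 1)]) _ _ (leq0n M) (gcomp_one H)) ?big_seq1 //.
exact: comul1.
Qed.

Lemma eq_dext f g :
  (forall k a, (k <= M)%N -> gcomp k a -> dext f a = dext g a) -> f = g.
Proof.
move=> e; apply: scalar_ext => x; rewrite -!dext_val.
have -> : val x = \sum_(k < M.+1) hproj k (val x).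
  by rewrite -[in LHS](tproj_id x).
rewrite (linear_sum (dext f)) (linear_sum (dext g)).
by apply: eq_bigr => k _; apply: (e k); [rewrite -ltnS|exact: gcomp_hproj].
Qed.

Lemma dext_gt f k a : (M < k)%N -> gcomp k a -> dext f a = 0.
Proof.
move=> Mk ak; rewrite dextE; have -> : tproj M a = 0; last exact: linear0.
apply: val_inj; rewrite /= /tproj_sum big1 // => i _.
by rewrite (hproj_id _ ak) ltn_eqF // (leq_trans (ltn_ord i)).
Qed.

Lemma strict_degreesP k a s p : gcomp k a -> strict_degrees k s ->
  p \in [:: (1, a), (a, 1) & s] ->
  exists2 i, (i <= k)%N & gcomp i p.1 /\ gcomp (k - i)%N p.2.
Proof.
have H1 := gcomp_one H.
move=> ak sk; rewrite !in_cons => /or3P[/eqP->|/eqP->|/sk[i [/andP[_ ik] p1 p2]]].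
- by exists 0%N; rewrite ?subn0.
- by exists k; rewrite ?subnn.
- by exists i; rewrite // ltnW.
Qed.

(* Every term of the coproduct of [a b] splits multiplicatively, except the one
   where [f] takes all of [a b] and the one where [g] does. *)
Lemma defectM f g j k l a b : (j < M)%N ->
  multiplicative_upto j (dext f) -> multiplicative_upto j (dext g) ->
  (0 < k)%N -> (0 < l)%N -> (k + l = j.+1)%N -> gcomp k a -> gcomp l b ->
  defect (dext (f * g)) a b = defect (dext f) a b + defect (dext g) a b.
Proof.
move=> jM [f1 fj] [g1 gj] k0 l0 klj ak bl.
have [_ [s [sk aE]]] := comul_gcomp k0 ak.
have [_ [t [tl bE]]] := comul_gcomp l0 bl.
have kM : (k <= M)%N by lia. have lM : (l <= M)%N by lia.
have klM : (k + l <= M)%N by lia.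
have abE : dext (f * g) (a * b) =
    \sum_(p <- [:: (1, a), (a, 1) & s]) \sum_(q <- [:: (1, b), (b, 1) & t])
      dext f (p.1 * q.1) * dext g (p.2 * q.2).
  rewrite -tform_tmul -aE -bE -comulM.
  by rewrite -[in RHS](tproj_gcomp klM (gcompM _ _ _ _ ak bl)) -convE.
rewrite {1}/defect abE (dextM _ _ kM ak aE) (dextM _ _ lM bl bE).
rewrite mulr_suml.
(* For [p] with both degrees positive, [p.1 * q.1] and [p.2 * q.2] have degree at most [j], so [f]
   and [g] split them and the row factors. *)
have split_row i p : p \in [:: (1, a), (a, 1) & s] -> gcomp i p.1 ->
    gcomp (k - i)%N p.2 -> (0 < i < k)%N ->
    \sum_(q <- [:: (1, b), (b, 1) & t]) dext f (p.1 * q.1) * dext g (p.2 * q.2) =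
    dext f p.1 * dext g p.2 *
      \sum_(q <- [:: (1, b), (b, 1) & t]) dext f q.1 * dext g q.2.
  move=> pin p1 p2 /andP[i0 ik]; rewrite mulr_sumr; apply: eq_big_seq => q.
  move=> /(strict_degreesP bl tl)[i' il [q1 q2]].
  by rewrite (fj i i') ?(gj (k - i)%N (l - i')%N) //; [ring|lia..].
rewrite !(big_cons _ _ (1, a)) !(big_cons _ _ (a, 1)) /=.
rewrite (_ : \sum_(p <- s) \sum_(q <- _) _ = \sum_(p <- s)
    dext f p.1 * dext g p.2 *
      \sum_(q <- [:: (1, b), (b, 1) & t]) dext f q.1 * dext g q.2); last first.
  apply: eq_big_seq => p ps; have [i [ik p1 p2]] := sk p ps.
  by apply: split_row p1 p2 ik; rewrite !in_cons ps !orbT.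
set S := \sum_(p <- s) _.
rewrite !big_cons /=.
have -> : \sum_(q <- t) dext f (1 * q.1) * dext g (a * q.2) =
    dext g a * \sum_(q <- t) dext f q.1 * dext g q.2.
  rewrite mulr_sumr; apply: eq_big_seq => q /tl[i [il q1 q2]].
  by rewrite mul1r (gj k (l - i)%N) //; [ring|lia].
have -> : \sum_(q <- t) dext f (a * q.1) * dext g (1 * q.2) =
    dext f a * \sum_(q <- t) dext f q.1 * dext g q.2.
  rewrite mulr_sumr; apply: eq_big_seq => q /tl[i [il q1 q2]].
  by rewrite mul1r (fj k i) //; [ring|lia].
by rewrite !mul1r !mulr1 /defect -!dextE f1 g1; ring.
Qed.

(** By [defectM] the defect of the product in each new degree is a sum of two defects that
    vanish. *)
Lemma multiplicative_uptoM f g j : (j <= M)%N ->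
  multiplicative_upto j (dext f) -> multiplicative_upto j (dext g) ->
  multiplicative_upto j (dext (f * g)).
Proof.
elim: j => [|j IH] jM fj gj.
  by apply: multiplicative_upto0; rewrite dextM1 fj.1 gj.1 mulr1.
have [fj' gj'] := (multiplicative_upto_le (leqnSn j) fj,
  multiplicative_upto_le (leqnSn j) gj).
apply: multiplicative_uptoS => [|k l a b k0 l0 klj ak bl].
  by apply: IH => //; exact: ltnW.
rewrite (defectM jM fj' gj' k0 l0 klj ak bl) /defect.
by rewrite (fj.2 k l) ?(gj.2 k l) ?klj // !subrr addr0.
Qed.

Lemma multiplicative_upto1 j : (j <= M)%N ->
  multiplicative_upto j (dext (1 : {scalar HM})).
Proof.
move=> jM; apply: (eq_multiplicative_upto (F := counit)).
  by move=> k a kj ak; rewrite (dext1 _ ak) // (leq_trans kj).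
exact: multiplicative_counit.
Qed.

(** [defectM] read backwards: the defects of [f] and of [f * g = 1] vanish, hence so does that of
    [g], degree by degree. *)
Lemma multiplicative_uptoV f g : f * g = 1 ->
  multiplicative_upto M (dext f) -> multiplicative_upto M (dext g).
Proof.
move=> fg fM; have g1 : dext g 1 = 1.
  by have := multiplicative_upto1 (leqnn M); rewrite -fg => -[+ _];
    rewrite dextM1 fM.1 mul1r.
suff gj j : (j <= M)%N -> multiplicative_upto j (dext g) by exact: gj.
elim: j => [|j IH] jM; first exact: multiplicative_upto0.
have gj := IH (ltnW jM); apply: multiplicative_uptoS => // k l a b k0 l0 klj ak bl.
have fj := multiplicative_upto_le (ltnW jM) fM.
have [_ oneM] := multiplicative_upto1 (leqnn M).
have := defectM jM fj gj k0 l0 klj ak bl.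
rewrite {1 2}/defect fg (oneM k l) ?klj // (fM.2 k l) ?klj // !subrr add0r.
by move=> <-.
Qed.

Definition vanishes_below i f : Prop :=
  forall k a, (k < i)%N -> (k <= M)%N -> gcomp k a -> dext f a = 0.

(** The degrees of the two factors of a coproduct term add up to [k < i + j], so one of them is
    below its threshold. It follows that functionals vanishing in degree 0 are nilpotent. *)
Lemma vanishes_belowM i j f g : vanishes_below i f -> vanishes_below j g ->
  vanishes_below (i + j) (f * g).
Proof.
move=> fi gj k a kij kM ak; have H1 := gcomp_one H.
case: (posnP k) => [k0|k0].
  rewrite k0 in ak; rewrite (counit_gcomp0 ak) scalarZ dextM1.
  case: (posnP i) => [i0|i0]; last by rewrite (fi 0%N) // mul0r mulr0.
  by rewrite (gj 0%N) ?mulr0 //; move: kij; rewrite i0 k0.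
have [_ [s [sk aE]]] := comul_gcomp k0 ak.
rewrite (dextM _ _ kM ak aE) big_seq big1 // => p.
move=> /(strict_degreesP ak sk)[l lk [p1 p2]].
have [li|il] := ltnP l i; first by rewrite (fi l) ?mul0r //; lia.
by rewrite (gj (k - l)%N) ?mulr0 //; lia.
Qed.

Lemma vanishes_belowX i f : vanishes_below 1 f -> vanishes_below i (f ^+ i).
Proof.
move=> f1; elim: i => [//|i IH]; rewrite exprS -add1n; exact: vanishes_belowM.
Qed.

Lemma vanishes_below_gt i f : (M < i)%N -> vanishes_below i f -> f = 0.
Proof.
move=> Mi fi; apply: eq_dext => k a kM ak; rewrite (fi k) //.
exact: leq_ltn_trans kM Mi.
Qed.

Lemma vanishes_below_sub1 f : dext f 1 = 1 -> vanishes_below 1 (f - 1).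
Proof.
move=> f1 k a; rewrite ltnS leqn0 => /eqP-> _ /counit_gcomp0->.
have [one1 _] := multiplicative_upto1 (leqnn M).
by rewrite scalarZ dextE scalarBE -!dextE f1 one1 subrr mulr0.
Qed.

(** The Neumann series of the inverse; it may stop at [M] because [1 - f] is nilpotent when [f]
    takes the value 1 at the unit. *)
Definition dinv f : {scalar HM} := \sum_(i < M.+1) (1 - f) ^+ i.

Lemma dinv_comm f : f * dinv f = dinv f * f.
Proof.
apply: commr_sum => i _; apply: commrX; apply: commrB; first exact: commr1.
exact: commr_refl.
Qed.

Lemma mulfd f : dext f 1 = 1 -> f * dinv f = 1.
Proof.
move=> f1; have v1 : vanishes_below 1 (1 - f).
  by rewrite -opprB => k a k1 kM ak; rewrite dextE scalarNE -dextE
    (vanishes_below_sub1 f1 k1 kM ak) oppr0.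
have := subrX1 (1 - f) M.+1.
rewrite (vanishes_below_gt (ltnSn M) (vanishes_belowX v1)) sub0r.
by rewrite [1 - f - 1]addrAC subrr add0r mulNr => /oppr_inj.
Qed.

Lemma muldf f : dext f 1 = 1 -> dinv f * f = 1.
Proof. by move=> f1; rewrite -dinv_comm mulfd. Qed.

Lemma conv_inv_eq f g : f * g = 1 -> g * f = 1 -> conv_inv f = g.
Proof.
move=> fg gf; rewrite /conv_inv; case: pselect => [e|[]]; last by exists g.
case: cid => h /= [fh hf].
by rewrite -[LHS](mulr1 (h : {scalar HM})) -fg mulrA -[h * f]/(conv h f) hf mul1r.
Qed.

End Convolution.

(** * Binomial coefficients as polynomials *)

Section BinomialPolynomials.
Variable R : numFieldType.

Definition binpoly k : {poly R} :=
  (k`!%:R)^-1 *: \prod_(i < k) ('X - i%:R%:P).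

Lemma horner_binpoly k m : (binpoly k).[m%:R] = 'C(m, k)%:R.
Proof.
have k0 : k`!%:R != 0 :> R by rewrite pnatr_eq0 -lt0n fact_gt0.
rewrite hornerZ horner_prod; apply: (mulfI k0); rewrite mulVKf // -natrM.
rewrite mulnC bin_ffact; elim: k {k0} => [|k IH]; first by rewrite big_ord0.
rewrite big_ord_recr /= IH hornerXsubC ffactnSr natrM.
(* The natural subtraction [m - k] is truncated, but for [m < k] the falling factorial in front of
   it is already zero. *)
by have [km|mk] := leqP k m; [rewrite natrB|rewrite ffact_small // !mul0r].
Qed.

(** In characteristic 0 the integers below [size p] are distinct roots, too many for a nonzero
    polynomial. *)
Lemma poly_nat_eq0 (p : {poly R}) : (forall m : nat, p.[m%:R] = 0) -> p = 0.
Proof.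
move=> p0; apply: (@roots_geq_poly_eq0 _ p [seq i%:R | i <- iota 0 (size p)]).
- by apply/allP => _ /mapP[i _ ->]; apply/rootP.
- by rewrite map_inj_uniq ?iota_uniq // => i j /eqP; rewrite eqr_nat => /eqP.
- by rewrite size_map size_iota.
Qed.

End BinomialPolynomials.

(** * Changing the truncation level *)

Section ChangeLevel.
Variables (R : comNzRingType) (H : gradedHopfType R).

(* Restriction of functionals when [M' <= M], extension by zero otherwise. *)
Definition dres M M' (f : {scalar truncated H M}) : {scalar truncated H M'} :=
  scalar_comp (dext f) val.

Lemma dext_dres M M' (f : {scalar truncated H M}) k a : (k <= M')%N ->
  gcomp k a -> dext (dres M' f) a = dext f a.
Proof. by move=> kM ak; rewrite -[in RHS](tproj_gcomp kM ak). Qed.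

(** The coproduct of an element of degree [k] involves only degrees up to [k], so restriction
    commutes with convolution. *)
Lemma dresM M M' (f g : {scalar truncated H M}) : (M' <= M)%N ->
  dres M' (f * g) = dres M' f * dres M' g.
Proof.
move=> MM'; apply: eq_dext => k a kM ak.
rewrite (dext_dres _ kM ak); have kM2 := leq_trans kM MM'.
case: (posnP k) => [k0|k0].
  rewrite k0 in ak; rewrite (counit_gcomp0 ak) !scalarZ !dextM1.
  by rewrite !(dext_dres _ (leq0n M') (gcomp_one H)).
have [_ [s [sk aE]]] := comul_gcomp k0 ak.
rewrite (dextM _ _ kM ak aE) (dextM _ _ kM2 ak aE).
apply: eq_big_seq => p /(strict_degreesP ak sk)[l lk [p1 p2]].
rewrite (dext_dres _ _ p1); last exact: leq_trans lk kM.
by rewrite (dext_dres _ _ p2) // (leq_trans (leq_subr _ _)).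
Qed.

End ChangeLevel.

(** * The multiplicative lift to degree [n + 1] *)

Section Lift.
Variables (R : numFieldType) (H : gradedHopfType R) (n : nat).
Implicit Types (X : {scalar truncated H n}) (a b : H) (k l : nat).

Definition ext0 X : {scalar truncated H n.+1} := dres n.+1 X.

Lemma dext_ext0 X k a : (k <= n.+1)%N -> gcomp k a -> dext (ext0 X) a = dext X a.
Proof. exact: dext_dres. Qed.

Lemma ext0_multiplicative X : multiplicative_upto n (dext X) ->
  multiplicative_upto n (dext (ext0 X)).
Proof.
apply: eq_multiplicative_upto => k a kn ak.
by rewrite (dext_ext0 _ _ ak) // leqW.
Qed.

(* [log X], except that its component of degree [n + 1] is the one of the
   logarithm of the extension of [X] by [0]; the coefficient of [m] in
   ['C(m, i)] is [(-1)^(i-1) / i]. *)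
Definition dlog X : {scalar truncated H n.+1} :=
  \sum_(i < n.+2) (binpoly R i)`_1 *: (ext0 X - 1) ^+ i.

(** Interpolates, as a polynomial in [m], the value at [a] of the [m]-th convolution power of
    [ext0 X]; its coefficient of degree 1 is the logarithm. *)
Definition power_poly X a : {poly R} :=
  \sum_(i < n.+2) dext ((ext0 X - 1) ^+ i) a *: binpoly R i.

Lemma dext_dlog X a : dext (dlog X) a = (power_poly X a)`_1.
Proof.
rewrite dextE scalar_sumE coef_sum; apply: eq_bigr => i _.
by rewrite scalarZE [RHS]coefZ mulrC.
Qed.

Lemma horner_power_poly X a m : dext X 1 = 1 ->
  (power_poly X a).[m%:R] = dext (ext0 X ^+ m) a.
Proof.
move=> X1; rewrite horner_sum.
under eq_bigr do rewrite hornerZ horner_binpoly.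
have e1 : dext (ext0 X) 1 = 1 by rewrite (dext_ext0 _ _ (gcomp_one H)).
rewrite -[in RHS](subrK 1 (ext0 X)) exprD1n dextE scalar_sumE.
under [RHS]eq_bigr do rewrite scalarMnE -dextE -mulr_natr.
(* The two sums stop at [n + 1] and at [m]. Both extend to a common range, since [F i] vanishes for
   [i > n + 1] by nilpotency and for [i > m] because the binomial coefficient does. *)
pose F i := dext ((ext0 X - 1) ^+ i) a * 'C(m, i)%:R.
rewrite (big_ord_widen (m + n.+2) F (leq_addl _ _)).
rewrite [RHS](big_ord_widen (m + n.+2) F); last by rewrite addnS ltnS leq_addr.
rewrite big_mkcond [RHS]big_mkcond /=; apply: eq_bigr => i _.
have F0 j : (n.+1 < j)%N -> F j = 0.
  move=> nj; have /vanishes_belowX v := vanishes_below_sub1 e1.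
  by rewrite /F (vanishes_below_gt nj (v j)) dextE scalar0E mul0r.
have F0' j : (m < j)%N -> F j = 0.
  by move=> mj; rewrite /F bin_small // mulr0.
case: ltnP => [_|/F0->]; last by case: ifP.
by case: ltnP => [//|/F0' ->].
Qed.

Lemma ext0X_multiplicative X m : multiplicative_upto n (dext X) ->
  multiplicative_upto n (dext (ext0 X ^+ m)).
Proof.
move=> /ext0_multiplicative Xn; elim: m => [|m IH].
  exact: multiplicative_upto1.
by rewrite exprS; exact: multiplicative_uptoM.
Qed.

(** The defect is additive over the [m] factors, and each contributes [X(a) X(b)] because [ext0 X]
    vanishes in degree [n + 1], where [a * b] lies. *)
Lemma defect_ext0X X m k l a b : multiplicative_upto n (dext X) ->
  (0 < k)%N -> (0 < l)%N -> (k + l = n.+1)%N -> gcomp k a -> gcomp l b ->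
  defect (dext (ext0 X ^+ m)) a b = dext X a * dext X b *+ m.
Proof.
move=> Xn k0 l0 kln ak bl.
have kn : (k <= n.+1)%N by lia. have ln : (l <= n.+1)%N by lia.
have klM : (k + l <= n.+1)%N by rewrite kln.
elim: m => [|m IH].
  rewrite /defect (dext1 klM (gcompM _ _ _ _ ak bl)).
  by rewrite (dext1 kn ak) (dext1 ln bl) counitM subrr.
rewrite exprS (defectM (ltnSn n) (ext0_multiplicative Xn)
  (ext0X_multiplicative m Xn) k0 l0 kln ak bl) IH mulrS; congr (_ + _).
rewrite /defect (dext_ext0 X kn ak) (dext_ext0 X ln bl).
have kln' : (n < k + l)%N by rewrite kln.
rewrite (dext_ext0 X klM (gcompM _ _ _ _ ak bl)).
by rewrite (dext_gt X kln' (gcompM _ _ _ _ ak bl)) subr0.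
Qed.

(** [defect_ext0X] is an identity between polynomials at every natural [m]; the claim compares the
    coefficients of degree 1. *)
Lemma dlogM X k l a b : multiplicative_upto n (dext X) ->
  (0 < k)%N -> (0 < l)%N -> (k + l = n.+1)%N -> gcomp k a -> gcomp l b ->
  dext (dlog X) (a * b) = - (dext X a * dext X b).
Proof.
move=> Xn k0 l0 kln ak bl; have X1 := Xn.1.
have e : power_poly X (a * b) - power_poly X a * power_poly X b +
    (dext X a * dext X b) *: 'X = 0.
  apply: poly_nat_eq0 => m; rewrite hornerD hornerD hornerN hornerM hornerZ hornerX.
  rewrite !horner_power_poly // mulr_natr.
  by rewrite -(defect_ext0X m Xn k0 l0 kln ak bl) /defect addrC subrKA subrr.
(* The zeroth power is the counit, so constant terms vanish in positive degree, and the product of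
   the polynomials of [a] and [b] has no term of degree 1. *)
have c0 k' c : (0 < k')%N -> (k' <= n.+1)%N -> gcomp k' c -> (power_poly X c)`_0 = 0.
  move=> k'0 k'n ck; rewrite -horner_coef0 (horner_power_poly c 0 X1) expr0.
  by rewrite (dext1 k'n ck); have [] := comul_gcomp k'0 ck.
have := congr1 (fun p : {poly R} => p`_1) e.
rewrite !coefD coefN coefZ coefX coefM !big_ord_recl big_ord0 /= coef0 !mulr1.
rewrite (c0 k) ?(c0 l) //; [|lia..].
by rewrite mul0r mulr0 !addr0 subr0 -dext_dlog => /eqP; rewrite addr_eq0 => /eqP.
Qed.

(** When [X] takes the value 1 at the unit, this is the exponential of the logarithm stripped of its
    top component: a top-degree functional is killed by every functional vanishing in degree 0, so
    stripping it subtracts it unchanged from [ext0 X]. *)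
Definition dlift X : {scalar truncated H n.+1} :=
  ext0 X - dual_comp n.+1 (dlog X).

Lemma dext_dual_comp M (f : {scalar truncated H M}) i k a : (k <= M)%N ->
  gcomp k a -> dext (dual_comp i f) a = if i == k then dext f a else 0.
Proof.
move=> kM ak.
rewrite -[LHS]/(dext f (hproj i (val (tproj M a)))) (tproj_gcomp kM ak).
by rewrite (hproj_id _ ak); case: eqP => // _; rewrite linear0.
Qed.

Lemma dext_lift_low X k a : (k <= n)%N -> gcomp k a -> dext (dlift X) a = dext X a.
Proof.
move=> kn ak; have kn1 := leqW kn.
rewrite dextE scalarBE -!dextE (dext_ext0 _ kn1 ak) (dext_dual_comp _ _ kn1 ak).
by rewrite gtn_eqF // subr0.
Qed.

Lemma dext_lift_top X a : gcomp n.+1 a -> dext (dlift X) a = - dext (dlog X) a.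
Proof.
move=> an; rewrite dextE scalarBE -!dextE (dext_ext0 _ (leqnn _) an).
by rewrite (dext_gt _ (ltnSn n) an) (dext_dual_comp _ _ (leqnn _) an) eqxx sub0r.
Qed.

Lemma lift_multiplicative X : multiplicative_upto n (dext X) ->
  multiplicative_upto n.+1 (dext (dlift X)).
Proof.
move=> Xn; apply: multiplicative_uptoS => [|k l a b k0 l0 kln ak bl].
  apply: (eq_multiplicative_upto (F := dext X)) => // k a kn ak.
  by rewrite (dext_lift_low _ kn ak).
have abn : gcomp n.+1 (a * b) by rewrite -kln; exact: gcompM.
rewrite /defect (dext_lift_top _ abn) (dlogM Xn k0 l0 kln ak bl) opprK.
by rewrite (dext_lift_low _ _ ak) ?(dext_lift_low _ _ bl) ?subrr //; lia.
Qed.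

Lemma dres_lift X : dres n (dlift X) = X.
Proof.
by apply: eq_dext => k a kn ak; rewrite (dext_dres _ kn ak) (dext_lift_low _ kn ak).
Qed.

End Lift.

(** * Sewing of almost additive functions for exponents below 1 *)

Section Sewing.
Variable R : realType.

(** By Bernoulli's inequality [q^-m] grows at least linearly in [m], so a positive [x] would
    contradict the Archimedean property. *)
Lemma geometric_unbounded (q x D : R) : 0 < q -> q < 1 ->
  (forall m, x <= D * q ^+ m) -> x <= 0.
Proof.
move=> q0 q1 xD; rewrite leNgt; apply/negP => x0.
pose e := q^-1 - 1.
have e0 : 0 < e by rewrite subr_gt0 invf_gt1.
have bern m : 1 + m%:R * e <= q^-1 ^+ m.
  elim: m => [|m IH]; first by rewrite mul0r addr0 expr0.
  have q1e : q^-1 = 1 + e by rewrite /e addrC subrK.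
  rewrite exprS {1}q1e; apply: (@le_trans _ _ ((1 + e) * (1 + m%:R * e))).
    have : 0 <= m%:R * e * e by rewrite !mulr_ge0 // ltW.
    rewrite -natr1; lra.
  by apply: ler_wpM2l => //; rewrite addr_ge0 // ltW.
have xm m : x * (m%:R * e) <= D.
  have := xD m; rewrite -ler_pdivrMr ?exprn_gt0 // -exprVn; apply: le_trans.
  by rewrite ler_pM2l //; have := bern m; lra.
have := xm (Num.truncn (D / (x * e))).+1; rewrite leNgt => /negP; apply.
rewrite [_%:R * e]mulrC mulrA -ltr_pdivrMl ?mulr_gt0 // [_^-1 * _]mulrC.
exact: Num.Theory.truncnS_gt.
Qed.

(** The limit is the supremum of the lower bounds [u m - K q^m], which increase with [m] while the
    upper bounds [u m + K q^m] decrease. *)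
Lemma geometric_limit (q D : R) (u : nat -> R) : 0 < q -> q < 1 ->
  (forall m, `|u m.+1 - u m| <= D * q ^+ m) ->
  exists c, forall m, `|c - u m| <= D / (1 - q) * q ^+ m.
Proof.
(* [K] is the sum of the series [D q^i]; the relation [K - K q = D] makes the intervals around [u m]
   nested. *)
move=> q0 q1 uD; pose K := D / (1 - q); pose lo m := u m - K * q ^+ m.
have KD : K - K * q = D by rewrite /K; field; rewrite subr_eq0 gt_eqF.
have D0 : 0 <= D by have := uD 0%N; rewrite expr0 mulr1; exact: le_trans.
have K0 : 0 <= K by rewrite divr_ge0 // subr_ge0 ltW.
have step m : lo m <= lo m.+1 /\ u m.+1 + K * q ^+ m.+1 <= u m + K * q ^+ m.
  have := uD m; rewrite -KD /lo exprS ler_norml => /andP[].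
  by set w := q ^+ m; move=> h1 h2; split; lra.
have lo_le m j : (m <= j)%N -> lo m <= lo j.
  move=> mj; rewrite -(subnK mj); elim: (j - m)%N => // i IH.
  by apply: le_trans IH _; exact: (step _).1.
have hi_le m j : (m <= j)%N -> u j + K * q ^+ j <= u m + K * q ^+ m.
  move=> mj; rewrite -(subnK mj); elim: (j - m)%N => // i IH.
  by apply: le_trans IH; exact: (step _).2.
have lohi m j : lo m <= u j + K * q ^+ j.
  have l : forall i, lo i <= u i + K * q ^+ i.
    move=> i; rewrite /lo; have : 0 <= K * q ^+ i by rewrite mulr_ge0 // exprn_ge0 // ltW.
    by lra.
  have [mj|jm] := leqP m j; first exact: le_trans (lo_le _ _ mj) (l j).
  exact: le_trans (l m) (hi_le _ _ (ltnW jm)).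
pose S := [set lo m | m in setT]%classic.
have supS : has_sup S.
  split; first by exists (lo 0%N), 0%N.
  by exists (u 0%N + K * q ^+ 0) => _ [m _ <-].
exists (sup S) => m; rewrite ler_norml; apply/andP; split.
  have : lo m <= sup S by apply: ub_le_sup; [exact: supS.2|exists m].
  by rewrite /lo -/K; lra.
have : sup S <= u m + K * q ^+ m by apply: ge_sup => [|_ [j _ <-]]; [exact: supS.1|].
by rewrite -/K; lra.
Qed.

Variables (alpha : R) (alpha_gt0 : 0 < alpha) (alpha_lt1 : alpha < 1).

Local Notation q := (2^-1 `^ alpha).

(** This is where [alpha < 1] makes [2 q - 1] positive, the denominator of the error constant [E]
    below. *)
Lemma dyadic_rate_gt : 2^-1 < q.
Proof.
have h0 : 0 < 2^-1 :> R by rewrite invr_gt0.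
have e : 2^-1 = sequences.expR (ln 2^-1) :> R by rewrite lnK // posrE.
rewrite [ltLHS]e /powR (gt_eqF h0) ltr_expR.
have : ln 2^-1 < 0 :> R by rewrite ln_lt0 // h0 /= invf_lt1 // ltr1n.
by move: alpha_lt1; nra.
Qed.

Lemma dyadic_rate_lt1 : q < 1.
Proof.
have h0 : 0 < 2^-1 :> R by rewrite invr_gt0.
rewrite -[ltRHS]expR0 /powR (gt_eqF h0) ltr_expR pmulr_rlt0 //.
by rewrite ln_lt0 // h0 /= invf_lt1 // ltr1n.
Qed.

Lemma dyadic_rate_gt0 : 0 < q. Proof. by rewrite powR_gt0 // invr_gt0. Qed.

Lemma powR_dyadic m : (2^-1 ^+ m) `^ alpha = q ^+ m.
Proof.
have h0 : 0 <= 2^-1 :> R by rewrite invr_ge0.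
by rewrite -[2^-1 ^+ m]powR_mulrn // powRAC powR_mulrn // powR_ge0.
Qed.

Lemma powR_double (r : R) : 0 <= r -> (2 * r) `^ alpha <= 2 * r `^ alpha.
Proof.
move=> r0; rewrite powRM // ler_wpM2r ?powR_ge0 //.
by rewrite -[leRHS]powRr1 // ler_powR ?ler1n // ltW.
Qed.

Lemma le_powR (r s : R) : 0 <= r -> r <= s -> r `^ alpha <= s `^ alpha.
Proof.
move=> r0 rs; apply: ge0_ler_powR; rewrite ?nnegrE ?(ltW alpha_gt0) //.
exact: le_trans r0 rs.
Qed.

(** The times may come in any order: degenerate and reversed triples yield [h s s = 0] and the
    approximate antisymmetry of [h]. *)
Definition almost_additive (h : R -> R -> R) (C : R) : Prop :=
  forall s u t r, 0 <= s <= 1 -> 0 <= u <= 1 -> 0 <= t <= 1 ->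
    `|u - s| <= r -> `|t - u| <= r -> `|t - s| <= r ->
    `|h s t - h s u - h u t| <= C * r `^ alpha.

Definition dyadic m k : R := k%:R * 2^-1 ^+ m.

Lemma dyadic_double m k : dyadic m.+1 k.*2 = dyadic m k.
Proof. by rewrite /dyadic exprS -muln2 natrM; field. Qed.

Lemma dyadic01 m k : (k <= 2 ^ m)%N -> 0 <= dyadic m k <= 1.
Proof.
move=> km; rewrite mulr_ge0 ?ler0n ?exprn_ge0 ?invr_ge0 //=.
by rewrite /dyadic exprVn ler_pdivrMr ?exprn_gt0 // mul1r -natrX ler_nat.
Qed.

Lemma dyadic_succ m k : dyadic m k.+1 - dyadic m k = 2^-1 ^+ m.
Proof. by rewrite /dyadic -natr1; ring. Qed.

Variable V : lmodType R.
Variable h : R -> R -> {scalar V}.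

(* The values at the points of level [m + 1] lying midway between two points of
   level [m] are chosen so as to give equal errors on both sides. *)
Fixpoint dyadic_path m k : {scalar V} :=
  if m is m'.+1 then
    if odd k then
      2^-1 *: (dyadic_path m' k./2 + dyadic_path m' k./2.+1
               + h (dyadic m' k./2) (dyadic m k)
               - h (dyadic m k) (dyadic m' k./2.+1))
    else dyadic_path m' k./2
  else if k is 0 then 0 else h 0 1.

Definition dyadic_index m (t : R) : nat := Num.truncn (t * 2 ^+ m).

Definition approx_path m t : {scalar V} :=
  dyadic_path m (dyadic_index m t) + h (dyadic m (dyadic_index m t)) t.

Lemma dyadic_index_itv m t : 0 <= t ->
  dyadic m (dyadic_index m t) <= t < dyadic m (dyadic_index m t).+1.
Proof.
move=> t0; have p0 : 0 < 2 ^+ m :> R by rewrite exprn_gt0.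
have := truncn_itv (mulr_ge0 t0 (ltW p0)).
by rewrite /dyadic exprVn ler_pdivrMr // ltr_pdivlMr.
Qed.

Lemma dyadic_index_unique m t k : 0 <= t ->
  dyadic m k <= t < dyadic m k.+1 -> dyadic_index m t = k.
Proof.
move=> t0; have p0 : 0 < 2 ^+ m :> R by rewrite exprn_gt0.
by rewrite /dyadic exprVn ler_pdivrMr // ltr_pdivlMr // => /truncn_def.
Qed.

Lemma dyadic_index_half m t : 0 <= t ->
  (dyadic_index m.+1 t)./2 = dyadic_index m t.
Proof.
move=> t0; symmetry; apply: dyadic_index_unique => //.
have := dyadic_index_itv m.+1 t0; set k := dyadic_index _ _.
rewrite -!(dyadic_double m) => /andP[l r]; apply/andP; split.
  apply: le_trans l; rewrite ler_wpM2r ?exprn_ge0 ?invr_ge0 // ler_nat.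
  by rewrite -[leqRHS]odd_double_half leq_addl.
apply: lt_le_trans r _; rewrite ler_wpM2r ?exprn_ge0 ?invr_ge0 // ler_nat.
by rewrite -[k in leqLHS]odd_double_half doubleS; case: odd.
Qed.

Lemma dyadic_index_le m t : 0 <= t -> t <= 1 -> (dyadic_index m t <= 2 ^ m)%N.
Proof.
move=> t0 t1; rewrite -(ler_nat R) natrX; have /andP[+ _] := dyadic_index_itv m t0.
rewrite /dyadic exprVn ler_pdivrMr ?exprn_gt0 // => /le_trans; apply.
by rewrite -[leRHS]mul1r ler_wpM2r // exprn_ge0.
Qed.

Section Estimates.
Variables (v : V) (C : R) (hC : almost_additive (fun s t => h s t v) C).

Lemma almost_additive_ge0 : 0 <= C.
Proof.
have := @hC 0 0 0 1; rewrite lexx ler01 subrr normr0 ler01 powR1 mulr1.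
by move=> /(_ isT isT isT isT isT isT); exact: le_trans.
Qed.

(** The fixed point of the error recursion: [2 E q = E + C]. *)
Local Notation E := (C / (2 * q - 1)).

Let q12 := dyadic_rate_gt.

Lemma dyadic_error_ge0 : 0 <= E.
Proof.
by rewrite divr_ge0 ?almost_additive_ge0 // subr_ge0; move: q12; lra.
Qed.

Definition dyadic_error m k : R :=
  h (dyadic m k) (dyadic m k.+1) v - (dyadic_path m k.+1 v - dyadic_path m k v).

(** Level 0 has no error. With the chosen midpoint, the error on either half is, up to sign, half
    the difference of the parent's error and the additivity defect of [h]; this is the recursion
    solved by [E]. *)
Lemma dyadic_error_le m k : (k < 2 ^ m)%N -> `|dyadic_error m k| <= E * q ^+ m.
Proof.
rewrite /dyadic_error; elim: m k => [|m IH] k km.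
  rewrite expn0 ltnS leqn0 in km; rewrite (eqP km) /= /dyadic expr0 mul0r mul1r.
  by rewrite subr0 subrr normr0 expr0 mulr1 dyadic_error_ge0.
set j := k./2; have kE := odd_double_half k; rewrite -/j in kE.
have jm : (j < 2 ^ m)%N.
  by rewrite -ltn_double -[(2 ^ m).*2]mul2n -expnS (leq_ltn_trans _ km) // -kE leq_addl.
have {IH} := IH j jm.
set a := dyadic m j; set b := dyadic m j.+1; set u := dyadic m.+1 j.*2.+1.
have Ea : a = dyadic m.+1 j.*2 by rewrite dyadic_double.
have Eb : b = dyadic m.+1 j.*2.+2 by rewrite -doubleS dyadic_double.
have a01 : 0 <= a <= 1 by apply: dyadic01; exact: ltnW.
have b01 : 0 <= b <= 1 by exact: dyadic01.
have u01 : 0 <= u <= 1.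
  by apply: dyadic01; rewrite expnS mul2n ltn_double.
have p0 : 0 < 2^-1 ^+ m :> R by rewrite exprn_gt0 // invr_gt0.
have ua : u - a = 2^-1 ^+ m.+1 by rewrite Ea dyadic_succ.
have bu : b - u = 2^-1 ^+ m.+1 by rewrite Eb dyadic_succ.
have ba : b - a = 2^-1 ^+ m by rewrite dyadic_succ.
have pS : 2^-1 ^+ m.+1 <= 2^-1 ^+ m :> R by rewrite exprS; lra.
have pS0 : 0 <= 2^-1 ^+ m.+1 :> R by rewrite exprS; lra.
have d1 : `|h a b v - h a u v - h u b v| <= C * q ^+ m.
  rewrite -powR_dyadic; apply: hC => //;
  by rewrite (ua, bu, ba) ger0_norm // ltW.
set ha := dyadic_path m j v; set hb := dyadic_path m j.+1 v.
have mid : dyadic_path m.+1 j.*2.+1 v = 2^-1 * (ha + hb + h a u v - h u b v).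
  have -> : dyadic_path m.+1 j.*2.+1 =
      2^-1 *: (dyadic_path m j + dyadic_path m j.+1 + h a u - h u b).
    by rewrite /= odd_double /= uphalf_double.
  by rewrite scalarZE scalarBE 2!scalarDE.
have hE : E * q ^+ m.+1 = 2^-1 * (E * q ^+ m) + 2^-1 * (C * q ^+ m).
  by rewrite exprS; field; rewrite gt_eqF //; move: q12; lra.
move=> d2.
have half (x y : R) : `|x| <= C * q ^+ m -> `|y| <= E * q ^+ m ->
    `|2^-1 * (y - x)| <= E * q ^+ m.+1.
  move=> x1 y1; rewrite normrM ger0_norm ?invr_ge0 // hE -mulrDr.
  rewrite ler_pM2l ?invr_gt0 //.
  by apply: le_trans (ler_normB _ _) _; exact: lerD.
have := half _ _ d1 d2; apply: le_trans; rewrite le_eqVlt; apply/orP; left.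
(* The interval is the right half of its parent for odd [k] and the left half for even [k]. *)
rewrite -kE; case: (odd k).
  rewrite add1n -doubleS dyadic_double -/u -/b.
  have -> : dyadic_path m.+1 j.+1.*2 v = hb by rewrite /= odd_double doubleK.
  by rewrite mid; apply/eqP; congr `|_|; field.
rewrite add0n dyadic_double -/u -/a.
have -> : dyadic_path m.+1 j.*2 v = ha by rewrite /= odd_double doubleK.
by rewrite mid; apply/eqP; congr `|_|; field.
Qed.

(** Refining moves the base point only when [t] lies in the right half of its interval; the change
    then consists of one additivity defect and one dyadic error of level [m + 1]. *)
Lemma approx_path_step m t : 0 <= t <= 1 ->
  `|approx_path m.+1 t v - approx_path m t v| <= (C + E) * q ^+ m.
Proof.
move=> t01; have [t0 t1] := andP t01.
have q0 := dyadic_rate_gt0; have q1 := dyadic_rate_lt1.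
have C0 := almost_additive_ge0; have E0 := dyadic_error_ge0.
rewrite /approx_path; have := dyadic_index_half m t0.
have := dyadic_index_le m.+1 t0 t1; have := dyadic_index_itv m.+1 t0.
have := dyadic_index_itv m t0.
set k := dyadic_index m.+1 t; set j := dyadic_index m t => tj tk kle kj.
have kE := odd_double_half k; rewrite kj in kE.
move: kE kle tk; case: (odd k) => <-; rewrite ?add0n => kle tk; last first.
  rewrite dyadic_double /= odd_double doubleK subrr normr0.
  by rewrite mulr_ge0 ?addr_ge0 // exprn_ge0 // ltW.
have jm : (j.*2 < 2 ^ m.+1)%N by [].
have := dyadic_error_le jm; rewrite /dyadic_error.
have -> : dyadic_path m.+1 j.*2 v = dyadic_path m j v.
  by rewrite /= odd_double doubleK.
rewrite dyadic_double add1n; set u := dyadic m.+1 j.*2.+1; set a := dyadic m j.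
have a01 : 0 <= a <= 1.
  by apply: dyadic01; rewrite -leq_double -[(2 ^ m).*2]mul2n -expnS ltnW.
have u01 : 0 <= u <= 1 by exact: dyadic01.
have /andP[at1 tb] := tj; have /andP[ut tb'] := tk; rewrite add1n -/u in ut.
have ba : dyadic m j.+1 = a + 2^-1 ^+ m by rewrite -(dyadic_succ m j) addrC subrK.
have ua : u = a + 2^-1 ^+ m.+1.
  by rewrite -(dyadic_succ m.+1 j.*2) dyadic_double addrC subrK.
have p0 : 0 < 2^-1 ^+ m.+1 :> R by rewrite exprn_gt0 // invr_gt0.
have pS : 2^-1 ^+ m.+1 <= 2^-1 ^+ m :> R by rewrite exprS; move: p0; rewrite exprS; lra.
rewrite -/a in at1; rewrite ba in tb.
have d1 : `|h a t v - h a u v - h u t v| <= C * q ^+ m.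
  rewrite -powR_dyadic; apply: hC => //;
  by rewrite ler_norml; apply/andP; split; lra.
move=> d2.
have d3 : E * q ^+ m.+1 <= E * q ^+ m.
  by rewrite ler_wpM2l // exprS ger_pMl ?exprn_gt0 // ltW.
move: d1 (le_trans d2 d3); rewrite mulrDl !ler_norml => /andP[? ?] /andP[? ?].
by rewrite !scalarDE; apply/andP; split; lra.
Qed.

(** At a level whose mesh is comparable to [t - s], the two times lie in the same or in adjacent
    intervals. The constant counts two additivity defects over at most two meshes, one dyadic error
    and two distances from [g] to [approx_path]; the outer 2 compares the mesh with [t - s]. *)
Lemma approx_path_holder (g : R -> R) D :
  (forall t m, 0 <= t <= 1 -> `|g t - approx_path m t v| <= D * q ^+ m) ->
  forall s t, 0 <= s <= 1 -> 0 <= t <= 1 -> s < t ->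
    `|h s t v - (g t - g s)| <= 2 * (4 * C + E + 2 * D) * (t - s) `^ alpha.
Proof.
move=> gD s t s01 t01 st; have [s0 s1] := andP s01; have [t0 t1] := andP t01.
have q0 := dyadic_rate_gt0; have q1 := dyadic_rate_lt1.
have C0 := almost_additive_ge0; have E0 := dyadic_error_ge0.
have D0 : 0 <= D by have := gD _ 0%N t01; rewrite expr0 mulr1; exact: le_trans.
have ts0 : 0 < t - s by rewrite subr_gt0.
(* [m] is minimal with [2^-(m+1) < t - s]. *)
have [m mst tsm] : exists2 m, t - s <= 2^-1 ^+ m & 2^-1 ^+ m <= 2 * (t - s).
  have ex : exists m, 2^-1 ^+ m.+1 < t - s.
    apply: contrapT => nex; have : t - s <= 0; last by rewrite leNgt ts0.
    apply: (@geometric_unbounded 2^-1 _ 1).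
    - by rewrite invr_gt0.
    - by rewrite invf_lt1 // ltr1n.
    move=> m; rewrite mul1r leNgt; apply/negP => lt; apply: nex; exists m.
    apply: le_lt_trans lt; rewrite exprS ger_pMl ?exprn_gt0 ?invr_gt0 //.
    by rewrite invf_le1 // ler1n.
  have [m mP mmin] := ex_minnP ex.
  exists m; last by move: mP; rewrite exprS; lra.
  case: m mmin {mP} => [|m] mmin; first by rewrite expr0; lra.
  by rewrite leNgt; apply/negP => /mmin; rewrite ltnn.
have w0 : 0 <= q ^+ m by rewrite exprn_ge0 // ltW.
have key : `|h s t v - (g t - g s)| <= (4 * C + E + 2 * D) * q ^+ m.
  have := gD _ m s01; have := gD _ m t01; rewrite /approx_path.
  have := dyadic_index_itv m s0; have := dyadic_index_itv m t0.
  have := dyadic_index_le m t0 t1.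
  set j := dyadic_index m s; set k := dyadic_index m t => k1 tk sj.
  have p0 : 0 < 2^-1 ^+ m :> R by rewrite exprn_gt0 // invr_gt0.
  have jk : (j <= k)%N.
    rewrite -ltnS -(ltr_nat R) -(ltr_pM2r p0) -!/(dyadic _ _).
    by move: tk sj; lra.
  have kj : (k <= j.+1)%N.
    rewrite -ltnS -(ltr_nat R) -(ltr_pM2r p0) -!/(dyadic _ _).
    have := dyadic_succ m j.+1; move: tk sj mst; lra.
  have a01 : 0 <= dyadic m j <= 1 by apply: dyadic01; exact: leq_trans k1.
  have sucj := dyadic_succ m j.
  have wm : C * (2 * 2^-1 ^+ m) `^ alpha <= C * (2 * q ^+ m).
    by rewrite ler_wpM2l // -powR_dyadic powR_double // ltW.
  have [kj'|kj'] := eqVneq k j.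
    rewrite kj' in tk *.
    have : `|h (dyadic m j) t v - h (dyadic m j) s v - h s t v| <= C * (2 * q ^+ m).
      apply: le_trans wm; apply: hC => //;
      by rewrite ler_norml; apply/andP; split; lra.
    rewrite !scalarDE.
    have EW : 0 <= E * q ^+ m by rewrite mulr_ge0.
    have CW : 0 <= C * q ^+ m by rewrite mulr_ge0.
    rewrite !ler_norml => /andP[? ?] /andP[? ?] /andP[? ?].
    by apply/andP; split; lra.
  have kE : k = j.+1 by apply/eqP; rewrite eqn_leq kj ltn_neqAle eq_sym kj' jk.
  have jm : (j < 2 ^ m)%N by rewrite -kE.
  have := dyadic_error_le jm; rewrite /dyadic_error kE in tk *.
  have b01 : 0 <= dyadic m j.+1 <= 1 by exact: dyadic01.
  have : `|h (dyadic m j) t v - h (dyadic m j) s v - h s t v| <= C * (2 * q ^+ m).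
    apply: le_trans wm; apply: hC => //;
    by rewrite ler_norml; apply/andP; split; lra.
  have : `|h (dyadic m j) t v - h (dyadic m j) (dyadic m j.+1) v
           - h (dyadic m j.+1) t v| <= C * (2 * q ^+ m).
    apply: le_trans wm; apply: hC => //;
    by rewrite ler_norml; apply/andP; split; lra.
  rewrite !scalarDE.
  rewrite !ler_norml => /andP[? ?] /andP[? ?] /andP[? ?] /andP[? ?] /andP[? ?].
  by apply/andP; split; lra.
set K := 4 * C + E + 2 * D in key *.
have K0 : 0 <= K by rewrite !addr_ge0 // mulr_ge0.
apply: le_trans key _; rewrite [2 * K]mulrC -mulrA ler_wpM2l //.
rewrite -powR_dyadic; apply: le_trans (powR_double (ltW ts0)).
by apply: le_powR => //; rewrite exprn_ge0 // invr_ge0.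
Qed.

Lemma approx_path_lim t : 0 <= t <= 1 ->
  exists c, forall m, `|c - approx_path m t v| <= (C + E) / (1 - q) * q ^+ m.
Proof.
move=> t01; apply: geometric_limit; first exact: dyadic_rate_gt0.
  exact: dyadic_rate_lt1.
by move=> m; exact: approx_path_step.
Qed.

End Estimates.

Lemma geometric_eq (x y D : R) : (forall m, `|x - y| <= D * q ^+ m) -> x = y.
Proof.
move=> xy; apply/eqP; rewrite -subr_eq0 -normr_le0.
exact: geometric_unbounded dyadic_rate_gt0 dyadic_rate_lt1 xy.
Qed.

Lemma dyadic_path_eq0 v m k : (forall s t, h s t v = 0) -> dyadic_path m k v = 0.
Proof.
move=> h0; elim: m k => [|m IH] k /=; first by case: k => //=; rewrite h0.
case: odd; last exact: IH.
by rewrite scalarZE scalarBE 2!scalarDE !IH !h0 !addr0 subr0 mulr0.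
Qed.

(** [g t v] is the limit of [approx_path m t v], taken one vector at a time, so the constants depend
    on [v]. The second clause records the linear dependence on [h] in the form that lets [g] inherit
    vanishing properties of [h]. *)
Theorem sewing :
  (forall v, exists C, almost_additive (fun s t => h s t v) C) ->
  exists g : R -> {scalar V},
    (forall v, exists C, forall s t, 0 <= s <= 1 -> 0 <= t <= 1 ->
       `|h s t v - (g t v - g s v)| <= C * `|t - s| `^ alpha) /\
    (forall v, (forall s t, h s t v = 0) -> forall t, g t v = 0).
Proof.
move=> /choice[C hC]; have q0 := dyadic_rate_gt0.
pose D v := (C v + C v / (2 * q - 1)) / (1 - q).
have gex t : exists gt : {scalar V},
    (0 <= t <= 1 -> forall v m, `|gt v - approx_path m t v| <= D v * q ^+ m) /\
    (forall v, (forall s t, h s t v = 0) -> gt v = 0).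
  (* Nothing is estimated outside [[0, 1]]; there [g] is set to 0. *)
  have [t01|t01] := boolP (0 <= t <= 1); last by exists 0.
  have /choice[gt gtP] v := approx_path_lim (hC v) t01.
  (* Each approximation is linear in the vector, hence so is the limit, by uniqueness. *)
  have lin : scalar gt.
    move=> a x y.
    apply: (@geometric_eq _ _ (D (a *: x + y) + `|a| * D x + D y)) => m.
    have := gtP (a *: x + y) m; have := gtP x m; have := gtP y m.
    rewrite -!/(D _) linearP /=; set px := approx_path m t x.
    set py := approx_path m t y => gy gx gxy.
    have -> : gt (a *: x + y) - (a * gt x + gt y) =
      (gt (a *: x + y) - (a * px + py)) - a * (gt x - px) - (gt y - py) by ring.
    apply: le_trans (ler_normB _ _) _; rewrite !mulrDl lerD //.
    apply: le_trans (ler_normB _ _) _; rewrite lerD //.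
    by rewrite normrM -mulrA ler_wpM2l.
  exists (mk_scalar lin); split=> [_ v m|v v0]; first exact: gtP.
  apply: (@geometric_eq _ _ (D v)) => m; have := gtP v m.
  by rewrite /approx_path scalarDE v0 (dyadic_path_eq0 _ _ v0) addr0.
have /choice[g gP] := gex; exists g; split=> [v|v v0 t]; last exact: (gP t).2.
have gD t m (t01 : 0 <= t <= 1) := (gP t).1 t01 v m.
pose K := 2 * (4 * C v + C v / (2 * q - 1) + 2 * D v).
have ordered s t := approx_path_holder (hC v) gD (s := s) (t := t).
have diag s : 0 <= s <= 1 -> h s s v = 0.
  move=> s01; have := hC v s s s 0 s01 s01 s01.
  rewrite subrr normr0 powR0 ?gt_eqF // mulr0 subrr sub0r normrN normr_le0.
  by move=> /(_ (lexx _) (lexx _) (lexx _))/eqP.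
have C0 := almost_additive_ge0 (hC v).
exists (C v + `|K|) => s t s01 t01; have w0 := powR_ge0 `|t - s| alpha.
have [st|ts|<-] := ltgtP s t; last first.
- rewrite diag // !subrr normr0; apply: mulr_ge0; last exact: powR_ge0.
  exact: addr_ge0.
(* The triple [s, t, s] shows [h t s] to be close to [- h s t], which reduces reversed times to
   ordered ones. *)
- have ew : `|t - s| = s - t by rewrite distrC gtr0_norm ?subr_gt0.
  have := hC v s t s (s - t) s01 t01 s01.
  rewrite [`|s - t|]distrC ew subrr normr0 lexx subr_ge0 (ltW ts) diag // sub0r.
  move=> /(_ isT isT isT) anti; rewrite ew in w0 *.
  have -> : h s t v - (g t v - g s v) =
    - (- h s t v - h t s v) - (h t s v - (g s v - g t v)) by ring.
  apply: le_trans (ler_normB _ _) _; rewrite normrN mulrDl lerD //.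
  by apply: le_trans (ordered _ _ t01 s01 ts) _; rewrite ler_wpM2r // ler_norm.
have ew : `|t - s| = t - s by rewrite gtr0_norm ?subr_gt0.
rewrite ew in w0 *; apply: le_trans (ordered _ _ s01 t01 st) _.
rewrite -/K ler_wpM2r //; apply: le_trans (ler_norm _) _; rewrite lerDr //.
Qed.

End Sewing.

(** * Bounds graded by degree *)

Section GradedBounds.
Variables (R : realType) (T : Type) (D : T -> Prop).
Implicit Types (w f g : T -> R).

Definition dominated w f : Prop :=
  exists C, forall t, D t -> `|f t| <= C * w t.

Lemma eq_dominated w f g : (forall t, D t -> f t = g t) ->
  dominated w f -> dominated w g.
Proof. by move=> fg [C fC]; exists C => t Dt; rewrite -fg //; exact: fC. Qed.

Lemma dominated0 w : dominated w (fun=> 0).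
Proof. by exists 0 => t _; rewrite normr0 mul0r. Qed.

Lemma dominatedD w f g : dominated w f -> dominated w g ->
  dominated w (fun t => f t + g t).
Proof.
move=> [C fC] [C' gC]; exists (C + C') => t Dt.
by rewrite (le_trans (ler_normD _ _)) // mulrDl lerD ?fC ?gC.
Qed.

Lemma dominatedZ w f c : dominated w f -> dominated w (fun t => c * f t).
Proof.
move=> [C fC]; exists (`|c| * C) => t Dt.
by rewrite normrM -mulrA ler_wpM2l // fC.
Qed.

Lemma dominatedN w f : dominated w f -> dominated w (fun t => - f t).
Proof. by move=> [C fC]; exists C => t Dt; rewrite normrN fC. Qed.

Lemma dominatedM w w' f g : dominated w f -> dominated w' g ->
  dominated (fun t => w t * w' t) (fun t => f t * g t).
Proof.
move=> [C fC] [C' gC]; exists (C * C') => t Dt.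
by rewrite normrM mulrACA ler_pM ?fC ?gC.
Qed.

Lemma dominated_sum w (I : eqType) (r : seq I) (F : I -> T -> R) :
  (forall i, i \in r -> dominated w (F i)) ->
  dominated w (fun t => \sum_(i <- r) F i t).
Proof.
elim: r => [|i r IH] rF.
  by apply: (eq_dominated _ (dominated0 w)) => t _; rewrite big_nil.
apply: (eq_dominated (f := fun t => F i t + \sum_(j <- r) F j t)).
  by move=> t _; rewrite big_cons.
apply: dominatedD; first by apply: rF; rewrite mem_head.
by apply: IH => j jr; apply: rF; rewrite in_cons jr orbT.
Qed.

Lemma dominated_cst c : dominated (fun=> 1) (fun=> c).
Proof. by exists `|c| => t _; rewrite mulr1. Qed.

Lemma eq_dominatedw w w' f : (forall t, D t -> w t = w' t) ->
  dominated w f -> dominated w' f.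
Proof. by move=> ww [C fC]; exists C => t Dt; rewrite -ww //; exact: fC. Qed.

Variable d : T -> R.
Variables (H : gradedHopfType R) (M : nat).
Implicit Types F G : T -> {scalar truncated H M}.

(** The constants depend on [a]; [graded_bound_gauge] extracts a uniform one from the finiteness of
    the basis. *)
Definition graded_bound F : Prop := forall k a, (k <= M)%N -> gcomp k a ->
  dominated (fun t => d t ^+ k) (fun t => dext (F t) a).

Lemma graded_boundZ c F : graded_bound F -> graded_bound (fun t => c *: F t).
Proof. by move=> FB k a kM ak; apply: dominatedZ; exact: FB. Qed.

Lemma graded_boundB F G : graded_bound F -> graded_bound G ->
  graded_bound (fun t => F t - G t).
Proof.
move=> FB GB k a kM ak; apply: dominatedD; first exact: FB.
by apply: dominatedZ; exact: GB.
Qed.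

Lemma graded_bound1 : graded_bound (fun=> 1).
Proof.
move=> k a kM ak; case: (posnP k) => [k0|k0].
  apply: (eq_dominatedw _ (dominated_cst _)) => t _.
  by rewrite k0 expr0.
apply: (eq_dominated _ (dominated0 _)) => t _.
by rewrite (dext1 kM ak) (comul_gcomp k0 ak).1.
Qed.

Lemma graded_bound_sum (I : eqType) (r : seq I) (F : I -> _) :
  (forall i, i \in r -> graded_bound (F i)) ->
  graded_bound (fun t => \sum_(i <- r) F i t).
Proof.
move=> rF k a kM ak.
apply: (eq_dominated (f := fun t => \sum_(i <- r) dext (F i t) a)).
  by move=> t _; rewrite dextE scalar_sumE.
by apply: dominated_sum => i ir; exact: rF.
Qed.

(** The two factors of a coproduct term have degrees [i] and [k - i], and [d^i d^(k-i) = d^k]. *)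
Lemma graded_boundM F G : graded_bound F -> graded_bound G ->
  graded_bound (fun t => F t * G t).
Proof.
move=> FB GB k a kM ak; have H1 := gcomp_one H.
case: (posnP k) => [k0|k0].
  rewrite k0 in ak *.
  apply: (eq_dominated (f := fun t => counit a * (dext (F t) 1 * dext (G t) 1))).
    by move=> t _; rewrite -dextM1 -scalarZ -(counit_gcomp0 ak).
  apply: dominatedZ.
  apply: (eq_dominatedw _ (dominatedM (FB _ _ (leq0n M) H1) (GB _ _ (leq0n M) H1))).
  by move=> t _; rewrite mulr1.
have [_ [s [sk aE]]] := comul_gcomp k0 ak.
apply: (eq_dominated (f := fun t => \sum_(p <- [:: (1, a), (a, 1) & s])
    dext (F t) p.1 * dext (G t) p.2)).
  by move=> t _; rewrite (dextM _ _ kM ak aE).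
apply: dominated_sum => p /(strict_degreesP ak sk)[i ik [p1 p2]].
have iM := leq_trans ik kM; have kiM := leq_trans (leq_subr i k) kM.
apply: (eq_dominatedw _ (dominatedM (FB _ _ iM p1) (GB _ _ kiM p2))) => t _.
by rewrite -exprD subnKC.
Qed.

Lemma graded_boundX F i : graded_bound F -> graded_bound (fun t => F t ^+ i).
Proof.
move=> FB; elim: i => [|i IH]; first exact: graded_bound1.
move=> k a kM ak; apply: eq_dominated (graded_boundM FB IH kM ak) => t _.
by rewrite exprS.
Qed.

End GradedBounds.

Lemma dominated_comp (R : realType) (T T' : Type) (D : T -> Prop) (D' : T' -> Prop)
    (p : T' -> T) (w f : T -> R) (w' : T' -> R) :
  (forall t, D' t -> D (p t)) -> (forall t, D' t -> 0 <= w (p t) <= w' t) ->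
  dominated D w f -> dominated D' w' (fun t => f (p t)).
Proof.
(* The constant is made nonnegative so that the weight can be enlarged. *)
move=> DD ww [C fC]; exists `|C| => t Dt; have /andP[w0 ww'] := ww t Dt.
apply: le_trans (fC _ (DD _ Dt)) _; apply: le_trans (ler_norm _) _.
by rewrite normrM (ger0_norm w0) ler_wpM2l.
Qed.

Lemma graded_bound_comp (R : realType) (T T' : Type) (D : T -> Prop)
    (D' : T' -> Prop) (p : T' -> T) (d : T -> R) (d' : T' -> R)
    (H : gradedHopfType R) M (F : T -> {scalar truncated H M}) :
  (forall t, D' t -> D (p t)) -> (forall t, D' t -> 0 <= d (p t) <= d' t) ->
  graded_bound D d F -> graded_bound D' d' (fun t => F (p t)).
Proof.
move=> DD dd FB k a kM ak; apply: dominated_comp (FB _ _ kM ak) => // t Dt.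
have /andP[d0 d1] := dd t Dt; rewrite exprn_ge0 //=.
by rewrite lerXn2r ?nnegrE // (le_trans d0).
Qed.

(** * Lifting preserves graded bounds *)

Section LiftBound.
Variables (R : realType) (T : Type) (D : T -> Prop) (d : T -> R).
Variables (H : gradedHopfType R) (n : nat) (X : T -> {scalar truncated H n}).
Hypothesis XB : graded_bound D d X.

Lemma graded_bound_ext0 : graded_bound D d (fun t => ext0 (X t)).
Proof.
move=> k a kn ak; have [kn'|nk] := leqP k n.
  by apply: eq_dominated (XB kn' ak) => t _; rewrite (dext_ext0 _ kn ak).
apply: eq_dominated (dominated0 _ _) => t _.
by rewrite (dext_ext0 _ kn ak) (dext_gt _ nk ak).
Qed.

(** In top degree the lift is minus [dlog], a polynomial in [ext0 X - 1] with fixed coefficients,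
    and graded bounds are stable under convolution. *)
Lemma graded_bound_lift : graded_bound D d (fun t => dlift (X t)).
Proof.
move=> k a kn ak; have [kn'|nk] := leqP k n.
  by apply: eq_dominated (XB kn' ak) => t _; rewrite (dext_lift_low _ kn' ak).
have kE : k = n.+1 by apply/eqP; rewrite eqn_leq kn.
have logB : graded_bound D d (fun t => dlog (X t)).
  apply: (graded_bound_sum
    (F := fun (i : 'I_n.+2) t => (binpoly R i)`_1 *: (ext0 (X t) - 1) ^+ i)).
  move=> i _; apply: graded_boundZ; apply: graded_boundX.
  by apply: graded_boundB; [exact: graded_bound_ext0|exact: graded_bound1].
apply: eq_dominated (dominatedN (logB _ _ kn ak)) => t _.
by rewrite kE in ak; rewrite (dext_lift_top _ ak).
Qed.

End LiftBound.

(** * Truncated characters as multiplicative functionals *)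

Section CharacterBridge.
Variables (R : realType) (H : gradedHopfType R) (M : nat).

(** The value at 1 is idempotent; if it were 0, then [X(a) = X(1) X(a)] would make [X] zero. *)
Lemma tchar_multiplicative (X : truncated_character H M) :
  multiplicative_upto M (dext X).
Proof.
have XM k l (a b : H) : (k + l <= M)%N -> gcomp k a -> gcomp l b ->
    dext X (a * b) = dext X a * dext X b.
  move=> klM ak bl; rewrite !dextE; apply: (tcharM X klM).
  - by rewrite (tproj_gcomp _ ak) //; lia.
  - by rewrite (tproj_gcomp _ bl) //; lia.
  rewrite (tproj_gcomp klM (gcompM _ _ _ _ ak bl)).
  by rewrite (tproj_gcomp _ ak) ?(tproj_gcomp _ bl) //; lia.
split=> //; have H1 := gcomp_one H.
have X1 : dext X 1 = dext X 1 * dext X 1 by rewrite -(XM 0%N 0%N) ?mulr1.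
have [x Xx] := tchar_neq0 X; have [e|e] := eqVneq (dext X 1) 0; last first.
  by apply: (mulfI e); rewrite mulr1 -X1.
case/eqP: Xx; suff -> : X = 0 :> {scalar truncated H M} by [].
apply: eq_dext => k a kM ak; rewrite [RHS]dextE scalar0E.
by rewrite -[a]mul1r (XM 0%N k) // e mul0r.
Qed.

Lemma multiplicative_tchar (f : {scalar truncated H M}) :
  multiplicative_upto M (dext f) ->
  exists X : truncated_character H M, tchar_val X = f.
Proof.
move=> [f1 fM].
have f0 : exists x, f x != 0 by exists (tproj M 1); rewrite -dextE f1 oner_eq0.
have fmul k l (x y xy : truncated H M) : (k + l <= M)%N ->
    gcomp k (val x) -> gcomp l (val y) -> val xy = val x * val y ->
    f xy = f x * f y.
  by move=> klM xk yl e; rewrite -!dext_val e; exact: fM xk yl.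
by exists (TruncatedCharacter f0 fmul).
Qed.

End CharacterBridge.

(** * Comparing the gauge with graded bounds *)

Section GaugeBounds.
Variables (R : realType) (H : gradedHopfType R) (M : nat).
Variable B : homogeneous_basis H M.
Local Notation HM := (truncated H M).

(** If the constant were 0, the coproduct of [H_M] would vanish, and with it the convolution square
    of [conv1], which is [conv1] and takes the value 1 at the unit. *)
Lemma hb_const_gt0 : 0 < hb_const B.
Proof.
rewrite lt_def bigmax_ge_id andbT; apply/eqP => K0.
have c0 i j l : hb_coef (B := B) i j l = 0.
  apply/eqP; rewrite -normr_le0 -K0 /hb_const.
  apply: le_trans (le_bigmax _ _ i); rewrite (bigD1 j) //= (bigD1 l) //=.
  by rewrite -addrA lerDl addr_ge0 // ?sumr_ge0 // => *; rewrite sumr_ge0.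
have tB i : tcomul (B i) = 0.
  rewrite hb_coefE big1 // => j _; rewrite big1 // => l _.
  by rewrite c0 scale0r.
have [_ /(_ (tproj M 1) I)[a [aE _]]] := hb_basis B.
have := conv1_one H M; rewrite -[conv1 H M]mulr1 -[_ * _]/(conv _ _) conv_form.
rewrite aE (linear_sum (@tcomul R H M)) big1.
  by rewrite linear0 => /eqP; rewrite eq_sym oner_eq0.
by move=> i _; rewrite linearZ /= tB scaler0.
Qed.

Lemma dual_comp_gcomp (f : {scalar HM}) k a : (k <= M)%N -> gcomp k a ->
  dual_comp k f (tproj M a) = dext f a.
Proof. by move=> kM ak; rewrite -dextE (dext_dual_comp _ _ kM ak) eqxx. Qed.

Lemma gauge_ge0 (f : {scalar HM}) : 0 <= gauge B f.
Proof. exact: bigmax_ge_id. Qed.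

Lemma dual_norm_ge0 (f : {scalar HM}) : 0 <= dual_norm B f.
Proof. by rewrite mulr_ge0 ?(ltW hb_const_gt0) // bigmax_ge_id. Qed.

Variables (T : Type) (D : T -> Prop) (d : T -> R) (d_ge0 : forall t, 0 <= d t).
Variable F : T -> {scalar HM}.

(** The [k]-th power undoes the root in the gauge and bounds the values on the basis, hence on [a]
    by expansion. The gauge does not see degree 0, which the value at 1 settles. *)
Lemma gauge_graded_bound : (forall t, D t -> dext (F t) 1 = 1) ->
  dominated D d (fun t => gauge B (F t)) -> graded_bound D d F.
Proof.
move=> F1 [C FC] k a kM ak; case: (posnP k) => [k0|k0].
  rewrite k0 in ak *; apply: (eq_dominated (f := fun=> counit a)).
    by move=> t Dt; rewrite (counit_gcomp0 ak) !scalarZ F1 // counit1.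
  by apply: (eq_dominatedw _ (dominated_cst _ _)) => t _; rewrite expr0.
have [_ /(_ (tproj M a) I)[c [cE _]]] := hb_basis B.
apply: (eq_dominated (f := fun t => \sum_i c i * dual_comp k (F t) (B i))).
  move=> t _; rewrite -(dual_comp_gcomp _ kM ak) cE linear_sum.
  by apply: eq_bigr => i _; rewrite scalarZ.
apply: dominated_sum => i _; apply: dominatedZ.
exists (C ^+ k / (k`!%:R * hb_const B)) => t Dt.
have f0 : 0 < k`!%:R * hb_const B by rewrite mulr_gt0 ?hb_const_gt0 // ltr0n fact_gt0.
rewrite mulrAC -exprMn ler_pdivlMr // mulrC -mulrA.
set n := k`!%:R * dual_norm B (dual_comp k (F t)).
apply: (@le_trans _ _ n).
  rewrite /n /dual_norm !ler_wpM2l ?ler0n ?(ltW hb_const_gt0) //.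
  exact: (le_bigmax _ (fun i => `|dual_comp k (F t) (B i)|)).
have n0 : 0 <= n by rewrite mulr_ge0 ?dual_norm_ge0.
have -> : n = (n `^ k%:R^-1) ^+ k.
  by rewrite -powR_mulrn ?powR_ge0 // -powRrM mulVf ?powRr1 // pnatr_eq0 -lt0n.
have nC : n `^ k%:R^-1 <= C * d t.
  apply: le_trans (FC t Dt); apply: le_trans (ler_norm _).
  apply: (bigmax_sup_seq _ k) => //.
  by rewrite mem_index_iota k0 ltnS.
by rewrite lerXn2r ?nnegrE ?powR_ge0 // (le_trans _ nC) ?powR_ge0.
Qed.

Lemma uniform_bound (I : eqType) (r : seq I) (f : I -> T -> R) (w : T -> R) :
  (forall t, 0 <= w t) -> (forall i, i \in r -> dominated D w (f i)) ->
  exists2 C, 0 <= C & forall i t, i \in r -> D t -> `|f i t| <= C * w t.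
Proof.
move=> w0; elim: r => [|i r IH] rf; first by exists 0.
have [C fC] := rf i (mem_head i r).
have [j jr|C' C'0 fC'] := IH _; first by apply: rf; rewrite in_cons jr orbT.
exists (`|C| + C') => [|j t]; first exact: addr_ge0.
rewrite in_cons => /orP[/eqP->|jr] Dt.
  apply: le_trans (fC _ Dt) _; rewrite ler_wpM2r //.
  by apply: le_trans (ler_norm _) _; rewrite lerDl.
by apply: le_trans (fC' _ _ jr Dt) _; rewrite ler_wpM2r // lerDr.
Qed.

(** The constants of finitely many basis elements and degrees have a common bound, and the [k]-th
    root turns [d^k] back into [d]. *)
Lemma graded_bound_gauge : graded_bound D d F ->
  dominated D d (fun t => gauge B (F t)).
Proof.
move=> FB.
pose G k t := (k`!%:R * dual_norm B (dual_comp k (F t))) `^ k%:R^-1.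
have GB k : k \in index_iota 1 M.+1 -> dominated D d (G k).
  rewrite mem_index_iota ltnS => /andP[k0 kM].
  have [C C0 bC] : exists2 C, 0 <= C & forall i t,
      i \in enum 'I_(hb_dim B) -> D t ->
      `|dual_comp k (F t) (B i)| <= C * d t ^+ k.
    apply: uniform_bound => [t|i _]; first exact: exprn_ge0.
    exact: (FB k (hproj k (val (B i))) kM (gcomp_hproj _ _)).
  pose A := k`!%:R * (hb_const B * C).
  have A0 : 0 <= A by rewrite !mulr_ge0 ?(ltW hb_const_gt0).
  exists (A `^ k%:R^-1) => t Dt; rewrite ger0_norm ?powR_ge0 //.
  have -> : d t = (d t ^+ k) `^ k%:R^-1.
    by rewrite -powR_mulrn // -powRrM divff ?powRr1 // pnatr_eq0 -lt0n.
  rewrite -powRM ?exprn_ge0 // ge0_ler_powR ?invr_ge0 ?nnegrE //.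
  - by rewrite mulr_ge0 ?dual_norm_ge0.
  - by rewrite mulr_ge0 ?exprn_ge0.
  rewrite /A -!mulrA ler_wpM2l // /dual_norm ler_wpM2l ?(ltW hb_const_gt0) //.
  apply: bigmax_le => [|i _]; first by rewrite mulr_ge0 ?exprn_ge0.
  by apply: bC; rewrite ?mem_enum.
have [C C0 gC] := uniform_bound d_ge0 GB.
exists C => t Dt; rewrite ger0_norm ?gauge_ge0 // /gauge big_seq.
apply: bigmax_le => [|k kr]; first exact: mulr_ge0.
by apply: le_trans (gC k t kr Dt); exact: ler_norm.
Qed.

End GaugeBounds.

(** * Functionals concentrated in top degree *)

Section TopDegree.
Variables (R : comNzRingType) (H : gradedHopfType R) (n : nat).
Implicit Types f g : {scalar truncated H n.+1}.

(** In the coproduct of [a], only the term [1 ⊗ a] can have a second factor of degree [n + 1]. *)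
Lemma mul_top f g : dext f 1 = 1 -> vanishes_below n.+1 g -> f * g = g.
Proof.
move=> f1 g0; apply: eq_dext => k a kn ak; have H1 := gcomp_one H.
case: (posnP k) => [k0|k0].
  rewrite k0 in ak; rewrite (counit_gcomp0 ak) !scalarZ dextM1.
  by rewrite (g0 0%N 1) // mulr0.
have [_ [s [sk aE]]] := comul_gcomp k0 ak.
rewrite (dextM _ _ kn ak aE) !big_cons f1 mul1r (g0 0%N 1) // mulr0 add0r.
rewrite big_seq big1 ?addr0 // => p /sk[i [/andP[i0 ik] _ p2]].
by rewrite (g0 (k - i)%N) ?mulr0 //; lia.
Qed.

Lemma top_mul f g : dext f 1 = 1 -> vanishes_below n.+1 g -> g * f = g.
Proof.
move=> f1 g0; apply: eq_dext => k a kn ak; have H1 := gcomp_one H.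
case: (posnP k) => [k0|k0].
  rewrite k0 in ak; rewrite (counit_gcomp0 ak) !scalarZ dextM1.
  by rewrite (g0 0%N 1) // mul0r.
have [_ [s [sk aE]]] := comul_gcomp k0 ak.
rewrite (dextM _ _ kn ak aE) !big_cons f1 mulr1 (g0 0%N 1) // mul0r add0r.
rewrite big_seq big1 ?addr0 // => p /sk[i [/andP[i0 ik] p1 _]].
by rewrite (g0 i) ?mul0r //; lia.
Qed.

(* In top degree, [f * g] depends on the top-degree components of [f] and [g]
   only through their sum. *)
Lemma dextM_top f g f' g' a :
  (forall k b, (k <= n)%N -> gcomp k b -> dext f b = dext f' b) ->
  (forall k b, (k <= n)%N -> gcomp k b -> dext g b = dext g' b) ->
  dext f 1 = 1 -> dext g 1 = 1 -> gcomp n.+1 a ->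
  dext (f * g) a - dext f a - dext g a = dext (f' * g') a - dext f' a - dext g' a.
Proof.
move=> ff gg f1 g1 an; have H1 := gcomp_one H.
have [_ [s [sk aE]]] := comul_gcomp (ltn0Sn n) an.
rewrite !(dextM _ _ (leqnn _) an aE) !big_cons f1 g1.
rewrite -(ff 0%N 1) // -(gg 0%N 1) // f1 g1.
rewrite (_ : \sum_(p <- s) dext f p.1 * dext g p.2 =
             \sum_(p <- s) dext f' p.1 * dext g' p.2); first by ring.
apply: eq_big_seq => p /sk[i [/andP[i0 ik] p1 p2]].
by rewrite (ff i) ?(gg (n.+1 - i)%N) //; lia.
Qed.

Lemma scalar_top f x : vanishes_below n.+1 f ->
  f x = dext f (hproj n.+1 (val x)).
Proof.
move=> f0; rewrite -dext_val.
have {1}-> : val x = \sum_(k < n.+2) hproj k (val x).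
  by rewrite -[in LHS](tproj_id x).
rewrite (linear_sum (dext f)) big_ord_recr big1 ?[LHS]add0r // => i _.
by apply: (f0 i); [|exact: ltnW|exact: gcomp_hproj].
Qed.

End TopDegree.

(** * Correcting the lifted path *)

Section Extension.
Variables (R : realType) (H : gradedHopfType R) (gamma : R) (n : nat).
Hypotheses (gamma_gt0 : 0 < gamma) (gamma_n : gamma * n.+1%:R < 1).
Variable X : R -> truncated_character H n.

Definition unit_pair (p : R * R) : Prop := 0 <= p.1 <= 1 /\ 0 <= p.2 <= 1.
Definition pair_weight (p : R * R) : R := `|p.2 - p.1| `^ gamma.

Hypothesis X_bound :
  graded_bound unit_pair pair_weight (fun p => dinv (X p.1) * X p.2).

Let XM t := tchar_multiplicative (X t).

(** In the notation of the overview, [lift_incr] is [S_s^-1 S_t], [incr_lift] is [A_st] and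
    [lift_diff] is [h_st]. *)
Definition incr s t : {scalar truncated H n} := dinv (X s) * X t.
Definition lift_incr s t : {scalar truncated H n.+1} :=
  dinv (dlift (X s)) * dlift (X t).
Definition incr_lift s t : {scalar truncated H n.+1} := dlift (incr s t).
Definition lift_diff s t := lift_incr s t - incr_lift s t.

Let X1 t : dext (X t) 1 = 1 := (XM t).1.

Lemma lift1 t : dext (dlift (X t)) 1 = 1.
Proof. exact: (lift_multiplicative (XM t)).1. Qed.

Lemma incrM s t : multiplicative_upto n (dext (incr s t)).
Proof.
apply: multiplicative_uptoM => //; apply: multiplicative_uptoV (XM s).
exact: mulfd.
Qed.

Lemma lift_incrM s t : multiplicative_upto n.+1 (dext (lift_incr s t)).
Proof.
apply: multiplicative_uptoM => //; last exact: lift_multiplicative.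
by apply: multiplicative_uptoV (lift_multiplicative (XM s)); exact: mulfd (lift1 s).
Qed.

Lemma incr_liftM s t : multiplicative_upto n.+1 (dext (incr_lift s t)).
Proof. exact/lift_multiplicative/incrM. Qed.

Lemma mul_lift_incr s t : dlift (X s) * lift_incr s t = dlift (X t).
Proof. by rewrite mulrA (mulfd (lift1 s)) mul1r. Qed.

(** Restriction to level [n] is multiplicative, so [mul_lift_incr] restricts to an identity from
    which [X s] is cancelled. *)
Lemma lift_incr_low s t k a : (k <= n)%N -> gcomp k a ->
  dext (lift_incr s t) a = dext (incr s t) a.
Proof.
move=> kn ak; rewrite -(dext_dres (M' := n) (lift_incr s t) kn ak); congr (dext _ a).
rewrite /incr -(dres_lift (X t)) -(mul_lift_incr s t) dresM // dres_lift.
by rewrite mulrA (muldf (X1 s)) mul1r.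
Qed.

Lemma incr_lift_low s t k a : (k <= n)%N -> gcomp k a ->
  dext (incr_lift s t) a = dext (incr s t) a.
Proof. exact: dext_lift_low. Qed.

Lemma lift_diff_low s t k a : (k <= n)%N -> gcomp k a -> dext (lift_diff s t) a = 0.
Proof.
move=> kn ak; rewrite dextE scalarBE -!dextE.
by rewrite (lift_incr_low _ _ kn ak) (incr_lift_low _ _ kn ak) subrr.
Qed.

(** Both functionals are multiplicative up to degree [n + 1] and agree on the factors, whose degrees
    are at most [n]. *)
Lemma lift_diff_prod s t k l a b : (0 < k)%N -> (0 < l)%N -> (k + l = n.+1)%N ->
  gcomp k a -> gcomp l b -> dext (lift_diff s t) (a * b) = 0.
Proof.
move=> k0 l0 kln ak bl; have kl : (k + l <= n.+1)%N by rewrite kln.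
rewrite dextE scalarBE -!dextE ((lift_incrM s t).2 k l) //.
rewrite ((incr_liftM s t).2 k l) //.
have kn : (k <= n)%N by lia. have ln : (l <= n)%N by lia.
rewrite (lift_incr_low _ _ kn ak) (lift_incr_low _ _ ln bl).
by rewrite (incr_lift_low _ _ kn ak) (incr_lift_low _ _ ln bl) subrr.
Qed.

Lemma lift_incr_comp s u t : lift_incr s u * lift_incr u t = lift_incr s t.
Proof.
by rewrite /lift_incr -mulrA (mulrA (dlift (X u))) (mulfd (lift1 u)) mul1r.
Qed.

(** The increments of the lift compose exactly, and by [dextM_top] the lifted increments may replace
    them once the linear top-degree terms are subtracted. *)
Lemma lift_diff_cocycle s u t a : gcomp n.+1 a ->
  dext (lift_diff s t) a - dext (lift_diff s u) a - dext (lift_diff u t) a =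
  dext (incr_lift s u * incr_lift u t) a - dext (incr_lift s t) a.
Proof.
move=> an.
have arith (d1 d2 d3 x y z x' y' z' p : R) : d1 = x - x' -> d2 = y - y' ->
    d3 = z - z' -> x - y - z = p - y' - z' -> d1 - d2 - d3 = p - x'.
  by move=> -> -> -> xyz; lra.
have low v w k b : (k <= n)%N -> gcomp k b ->
    dext (lift_incr v w) b = dext (incr_lift v w) b.
  by move=> kn bk; rewrite (lift_incr_low _ _ kn bk) (incr_lift_low _ _ kn bk).
have e := dextM_top (low s u) (low u t) (lift_incrM s u).1 (lift_incrM u t).1 an.
rewrite (lift_incr_comp s u t) in e.
have diffE v w :
    dext (lift_diff v w) a = dext (lift_incr v w) a - dext (incr_lift v w) a.
  exact: dextB.
exact: arith (diffE s t) (diffE s u) (diffE u t) e.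
Qed.

Let alpha := gamma * n.+1%:R.

Lemma powR_alpha (x : R) : (x `^ gamma) ^+ n.+1 = x `^ alpha.
Proof. by rewrite -powR_mulrn ?powR_ge0 // -powRrM. Qed.

Lemma alpha_gt0 : 0 < alpha. Proof. by rewrite mulr_gt0 // ltr0n. Qed.

(** The right-hand side of [lift_diff_cocycle] is built from lifted increments alone, so in degree
    [n + 1] it is of order [r^(gamma (n + 1))]. *)
Lemma lift_diff_almost_additive (x : truncated H n.+1) :
  exists C, almost_additive alpha (fun s t => lift_diff s t x) C.
Proof.
set a := hproj n.+1 (val x); have an : gcomp n.+1 a by exact: gcomp_hproj.
have xE s t : lift_diff s t x = dext (lift_diff s t) a.
  by apply: scalar_top => k b kn _; apply: lift_diff_low; rewrite -ltnS.
(* The three pairs of times are placed in one parameter space, to be bounded with the common weight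
   [r^gamma]. *)
pose quad := (R * R * R * R)%type.
pose D (q : quad) := let: (s, u, t, r) := q in
  [/\ 0 <= s <= 1, 0 <= u <= 1 & 0 <= t <= 1] /\
  [/\ `|u - s| <= r, `|t - u| <= r & `|t - s| <= r].
pose d (q : quad) := q.2 `^ gamma.
have lep (y r : R) : `|y| <= r -> 0 <= `|y| `^ gamma <= r `^ gamma.
  by move=> yr; rewrite powR_ge0 le_powR.
have Bsu : graded_bound D d (fun q => incr_lift q.1.1.1 q.1.1.2).
  apply: (graded_bound_comp (p := fun q : quad => (q.1.1.1, q.1.1.2)) _ _
    (graded_bound_lift X_bound)).
  - by move=> [[[s u] t] r] [[? ? ?] _]; split.
  - by move=> [[[s u] t] r] [_ [? _ _]]; exact: lep.
have But : graded_bound D d (fun q => incr_lift q.1.1.2 q.1.2).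
  apply: (graded_bound_comp (p := fun q : quad => (q.1.1.2, q.1.2)) _ _
    (graded_bound_lift X_bound)).
  - by move=> [[[s u] t] r] [[? ? ?] _]; split.
  - by move=> [[[s u] t] r] [_ [_ ? _]]; exact: lep.
have Bst : graded_bound D d (fun q => incr_lift q.1.1.1 q.1.2).
  apply: (graded_bound_comp (p := fun q : quad => (q.1.1.1, q.1.2)) _ _
    (graded_bound_lift X_bound)).
  - by move=> [[[s u] t] r] [[? ? ?] _]; split.
  - by move=> [[[s u] t] r] [_ [_ _ ?]]; exact: lep.
have [C CP] := graded_boundB (graded_boundM Bsu But) Bst (leqnn _) an.
exists C => s u t r s01 u01 t01 us tu ts.
have CPq : `|dext (incr_lift s u * incr_lift u t - incr_lift s t) a| <= C * r `^ alpha.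
  by rewrite -powR_alpha; apply: (CP (s, u, t, r)); split.
suff E : lift_diff s t x - lift_diff s u x - lift_diff u t x =
    dext (incr_lift s u * incr_lift u t - incr_lift s t) a by rewrite E.
apply: etrans (esym (dextB (incr_lift s u * incr_lift u t) _ a)).
by rewrite -(lift_diff_cocycle s u t an); congr (_ - _ - _); exact: xE.
Qed.

Lemma exists_extension : exists X' : R -> {scalar truncated H n.+1},
  [/\ forall t, multiplicative_upto n.+1 (dext (X' t)),
      forall t, dres n (X' t) = X t &
      graded_bound unit_pair pair_weight (fun p => dinv (X' p.1) * X' p.2)].
Proof.
have [g [gB g0]] := sewing alpha_gt0 gamma_n lift_diff_almost_additive.
have glow t : vanishes_below n.+1 (g t).
  move=> k a kn kn' ak; rewrite dextE; apply: g0 => s u.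
  by rewrite -dextE; apply: lift_diff_low ak; rewrite -ltnS.
have gprod t k l a b : (0 < k)%N -> (0 < l)%N -> (k + l = n.+1)%N ->
    gcomp k a -> gcomp l b -> dext (g t) (a * b) = 0.
  move=> k0 l0 kln ak bl; rewrite dextE; apply: g0 => s u.
  by rewrite -dextE; exact: lift_diff_prod kln ak bl.
pose X' t := dlift (X t) - g t.
have X'E t a : dext (X' t) a = dext (dlift (X t)) a - dext (g t) a.
  by rewrite dextE scalarBE.
have X'low t k a : (k <= n)%N -> gcomp k a -> dext (X' t) a = dext (X t) a.
  move=> kn ak; rewrite X'E (dext_lift_low _ kn ak) (glow t k) ?subr0 //.
  exact: leqW.
have X'M t : multiplicative_upto n.+1 (dext (X' t)).
  apply: multiplicative_uptoS => [|k l a b k0 l0 kln ak bl].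
    apply: eq_multiplicative_upto (XM t) => k a kn ak.
    by rewrite (X'low t k).
  have kn : (k <= n)%N by lia. have ln : (l <= n)%N by lia.
  rewrite /defect (X'low _ _ _ kn ak) (X'low _ _ _ ln bl) X'E.
  rewrite (gprod _ _ _ _ _ k0 l0 kln ak bl) subr0.
  rewrite ((lift_multiplicative (XM t)).2 k l) ?kln //.
  by rewrite (dext_lift_low _ kn ak) (dext_lift_low _ ln bl) subrr.
(* [Z] is the increment of [X']: top-degree functionals absorb factors with value 1 at the unit, so
   [g] enters linearly. *)
pose Z s t := lift_incr s t - (g t - g s).
have ZE s t : dinv (X' s) * X' t = Z s t.
  suff <- : X' s * Z s t = X' t by rewrite mulrA (muldf (X'M s).1) mul1r.
  have gB0 : vanishes_below n.+1 (g t - g s).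
    move=> k a kn kn' ak; rewrite dextE scalarBE -!dextE.
    by rewrite (glow t k) // (glow s k) // subrr.
  rewrite mulrBr (mul_top (X'M s).1 gB0) mulrBl mul_lift_incr.
  by rewrite (top_mul (lift_incrM s t).1 (glow s)) /X' opprB addrA subrK.
have ZbE s t b : dext (dinv (X' s) * X' t) b =
    dext (lift_incr s t) b - (dext (g t) b - dext (g s) b).
  by rewrite ZE (dextB (lift_incr s t)) (dextB (g t)).
exists X'; split=> // [t|k a kn ak].
  by apply: eq_dext => k a kn ak; rewrite (dext_dres _ kn ak) (X'low t k).
have [kn'|nk] := leqP k n.
  apply: eq_dominated (X_bound kn' ak) => p _.
  rewrite ZbE (glow p.2 k) // (glow p.1 k) // !subr0.
  by rewrite (lift_incr_low _ _ kn' ak).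
have kE : k = n.+1 by apply/eqP; rewrite eqn_leq kn.
have [C CP] := gB (tproj n.+1 a).
(* In top degree the increment is the lifted increment plus the sewing error, both of order
   [|t - s|^(gamma (n + 1))]. *)
apply: (eq_dominated (f := fun p => dext (incr_lift p.1 p.2) a +
    (dext (lift_diff p.1 p.2) a - (dext (g p.2) a - dext (g p.1) a)))).
  move=> p _; rewrite ZbE (dextB (lift_incr _ _)).
  by rewrite addrA [_ + (_ - _)]addrC subrK.
apply: dominatedD; first exact: (graded_bound_lift X_bound) kn ak.
exists C => -[s t] [/= s01 t01]; rewrite kE powR_alpha; exact: CP.
Qed.

End Extension.

(** * From graded bounds back to Hölder paths *)

Lemma dinv_incr_inv (R : comNzRingType) (H : gradedHopfType R) M
    (f g : {scalar truncated H M}) : dext f 1 = 1 -> dext g 1 = 1 ->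
  conv_inv (dinv f * g) = dinv g * f.
Proof.
move=> f1 g1; apply: conv_inv_eq.
  by rewrite -mulrA (mulrA g) mulfd // mul1r muldf.
by rewrite -mulrA (mulrA f) mulfd // mul1r muldf.
Qed.

(** The inverse of [X^-1 Y] is [Y^-1 X], so bounds on increments over all pairs of times, in either
    order, control both halves of the distance. *)
Lemma rhoE (R : realType) (H : gradedHopfType R) M (B : homogeneous_basis H M)
    (X Y : truncated_character H M) :
  rho B X Y = gauge B (dinv X * Y) + gauge B (dinv Y * X).
Proof.
have [X1 _] := tchar_multiplicative X; have [Y1 _] := tchar_multiplicative Y.
have XV : conv_inv X = dinv X by apply: conv_inv_eq; [exact: mulfd|exact: muldf].
by rewrite /rho /tchar_size XV convM dinv_incr_inv.
Qed.

Theorem theorem3p4 (R : realType) (H : gradedHopfType R) (gamma : R)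
    (gamma_gt0 : 0 < gamma) (gamma_lt1 : gamma < 1)
    (gammaV_nat : gamma^-1 \isn't a Num.nat)
    (n : nat) (n_ge1 : (1 <= n)%N)
    (n_le : n%:Z <= Num.floor gamma^-1 - 1)
    (B : homogeneous_basis H n) (B' : homogeneous_basis H n.+1)
    (X : R -> truncated_character H n) (X_holder : holder_path B gamma X) :
  exists X' : R -> truncated_character H n.+1,
    holder_path B' gamma X' /\
    (forall t : R, 0 <= t <= 1 ->
       forall x : truncated H n, X' t (tincl x) = X t x).
Proof.
(* [n + 1] is at most the floor of [gamma^-1], which is not an integer; hence the strict
   inequality. *)
have gamma_n : gamma * n.+1%:R < 1.
  have n_floor : n.+1%:R <= gamma^-1.
    rewrite -[n.+1%:R]/(n.+1%:Z%:~R) -Num.Theory.floor_ge_int_tmp.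
    by move: n_le; rewrite lerBrDr -addn1 PoszD.
  rewrite mulrC -ltr_pdivlMr // mul1r lt_def n_floor andbT.
  by apply: contra gammaV_nat => /eqP->; exact: Num.Theory.natr_nat.
have X_bound :
    graded_bound (@unit_pair R) (pair_weight gamma) (fun p => dinv (X p.1) * X p.2).
  apply: (gauge_graded_bound (B := B)) => [p _|].
    exact: (incrM X p.1 p.2).1.
  have [C CP] := X_holder; exists C => p [p1 p2].
  rewrite ger0_norm ?gauge_ge0 //; apply: le_trans (CP _ _ p1 p2).
  by rewrite rhoE lerDl gauge_ge0.
have [Y [YM Yres YB]] := exists_extension gamma_gt0 gamma_n X_bound.
have /choice[X' X'E] t := multiplicative_tchar (YM t).
exists X'; split=> [|t _ x]; last first.
  rewrite -Yres X'E -[RHS]/(Y t (tproj n.+1 (val x))); congr (Y t _).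
  by rewrite -[LHS]tproj_id.
have [C CP] := graded_bound_gauge B' (fun p => powR_ge0 _ _) YB.
exists (C + C) => s t s01 t01; rewrite rhoE !X'E mulrDl lerD //.
  by apply: le_trans (ler_norm _) _; exact: (CP (s, t)).
apply: le_trans (ler_norm _) _; rewrite distrC; exact: (CP (t, s)).
Qed.
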